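(* Let $F$ be a formula of a first-order language $\mathcal{L}$. Then $F$ is dialogically valid (i.e. there exists a winning strategy for $F$) if and only if $F$ is classically valid (i.e. $F$ is true in all interpretations).
   Context: **Language.** $\mathcal{L}$ is a first-order language; terms and formulas are defined as usual, with connectives $\wedge,\vee,\Rightarrow$ and quantifiers $\forall,\exists$. The negation $\neg F$ is defined as $F\Rightarrow\bot$, where $\bot$ is an arbitrary atomic formula. $F[t/x]$ is the formula in which the variable $x$ is replaced by the term $t$. The (Gentzen-)subformulas of $F$ are: $F$ itself; $F_1,F_2$ whenever $F_1\star F_2$ is a subformula ($\star\in\{\wedge,\vee,\Rightarrow\}$); $F'$ whenever $\neg F'$ is a subformula; $F'[t/x]$ for all $t$ free for $x$ in $F'$, whenever $QxF'$ is a subformula ($Q\in\{\forall,\exists\}$). **Attacks and defences.** Here $i\in\{1,2\}$, $x$ is an arbitrary variable and $t$ an arbitrary term. Attack symbols that are not formulas ($?\wedge_1$, $?\wedge_2$, $?\vee$, $?\exists$, $?\forall[t/x]$) are called auxiliary symbols. - Assertion $F_1\Rightarrow F_2$: attack $F_1$; defence $F_2$. - Assertion $F_1\wedge F_2$: attack $?\wedge_i$ ($i$ chosen by the attacker); defence $F_i$. - Assertion $F_1\vee F_2$: attack $?\vee$; defence $F_i$ ($i$ chosen by the defender). - Assertion $\forall xF$: attack $?\forall[t/x]$ (a universal attack; $t$ chosen by the attacker); defence $F[t/x]$. - Assertion $\exists xF$: attack $?\exists$ (an existential attack); defence $F[t/x]$ (an existential defence; $t$ chosen by the defender). There is no attack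 on an atomic formula. **Moves.** A move is a pair $(i,s)$ with $i\in\{?,!\}$ and $s$ a formula or an auxiliary symbol; it is an attack if $i={?}$ and a defence if $i={!}$. An attack $(?,F)$ with $F$ a formula is an assertion (of $F$), and all defences are assertions. A pre-justified sequence is a sequence of moves $M_0,M_1,\dots$ together with a partial function $f$ assigning to moves of the sequence strictly earlier moves of the sequence. An attack $M_n=(?,s)$ is justified if $f(M_n)$ is an assertion of some formula $F'$ and $s$ is an attack of $F'$. A defence $M_n=(!,F')$ is justified if $f(M_n)=(?,s)$ is a justified attack on an earlier move asserting $F''$, where $s$ attacks $F''$ and $F'$ is a defence from $s$. In both cases $f(M_n)$ is called the enabler of $M_n$. An assertion $M_n$ is a reprise if there is a move $M_j$ with smaller index and opposite parity that asserts the same formula. **Games.** A game for $F$ is a pre-justified sequence $M_0,M_1,\dots$ such that: (1) $M_0=(!,F)$, and all the moves $M_1,M_2,\dots$ are justified, each odd-index move being enabled by its immediate predecessor and each even-index move (of index $\geq 2$) being enabled by a preceding odd-index move; (2) if an even-index move asserts an atomic formula then it is a reprise; (3) for all even $m,n$, if $M_m$ and $M_n$ are defences that assert the same subformula occurrence of $F$ and are enabled by the same move, then $m=n$. Even-index moves are $\mathbf{P}$-moves (proponent), odd-index moves are $\mathbf{O}$-moves (opponent). A move $M$ is legal for a game $G$ if $G,M$ is a game. A game is won by $\mathbf{P}$ if it is finite, its last move is a $\mathbf{P}$-move, and no $\mathbf{O}$-move is legal for it; otherwise it is won by $\mathbf{O}$. **Strategies.** A variable appears in a game if it appears in some asserted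 formula or is free in the chosen term of some universal attack. Fix an enumeration of the variables. A strategy for $F$ is a nonempty prefix-closed set $S$ of games for $F$ (a tree of games) such that: 1. if $G\in S$ and the last move of $G$ is a $\mathbf{P}$-move that is neither an assertion of a universally quantified formula nor an existential attack, then $G,M\in S$ for every move $M$ legal for $G$; 2. if $G,M$ and $G,M'$ belong to $S$ and $M,M'$ are $\mathbf{P}$-moves, then $M=M'$; 3. if $G,M$ and $G,M'$ belong to $S$ and $M,M'$ are $\mathbf{O}$-moves and universal attacks, then $M=M'$; moreover the chosen term is the first variable in the enumeration that does not appear in $G$; 4. if $G,M$ and $G,M'$ belong to $S$ and $M,M'$ are $\mathbf{O}$-moves and existential defences, then $M=M'$; moreover the term chosen to defend is the first variable in the enumeration that does not appear in $G$; 5. if $G\in S$ and the last move of $G$ is an $\mathbf{O}$-move that is an attack against an existential quantifier, then $G,M\in S$, where $M$ is a defence against the last move of $G$. A strategy $S$ is winning if every maximal branch of $S$ (with respect to the prefix order) is a game won by $\mathbf{P}$; in particular there is no infinite branch. $F$ is dialogically valid if there exists a winning strategy for $F$.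
   Formalization: Strategies satisfy one more condition: after a P-attack asserting a universal formula, S contains every legal O-defence and some universal attack; literally, ((∀xP(x))⇒Q)⇒Q would be dialogically but not classically valid. Formulas are taken up to renaming of bound variables. *)

(* Defs.v *)
From mathcomp Require Import all_boot.
From mathcomp Require Import boolp.

Set Implicit Arguments.
Unset Strict Implicit.
Unset Printing Implicit Defensive.

(* Symbols of any cardinality; an arity may be 0. *)
Record language := Language {
  fun_symbol : Type;
  fun_arity : fun_symbol -> nat;
  rel_symbol : Type;
  rel_arity : rel_symbol -> nat }.

(* Formulas up to renaming of bound variables, in de Bruijn notation. The
   variables are the natural numbers; in the scope of a quantifier, index 0 is
   the bound variable and x.+1 is the variable called x outside, so that every
   term is free for the bound variable. There is no falsum: a negation is
   [Imp A bot] for an atomic formula [bot] chosen at will. *)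
Inductive term (L : language) : Type :=
| Var of nat
| App (f : fun_symbol L) of ('I_(fun_arity f) -> term L).

Inductive form (L : language) : Type :=
| Atom (p : rel_symbol L) of ('I_(rel_arity p) -> term L)
| And of form L & form L
| Or of form L & form L
| Imp of form L & form L
| All of form L
| Ex of form L.

Arguments Var {L}.

Section Syntax.
Variable L : language.
Implicit Types (t : term L) (A B : form L).

Fixpoint tsubst (s : nat -> term L) t : term L :=
  match t with
  | Var x => s x
  | App f a => App (fun i => tsubst s (a i))
  end.

Definition scons (T : Type) (a : T) (s : nat -> T) : nat -> T :=
  fun x => if x is y.+1 then s y else a.

Definition up (s : nat -> term L) : nat -> term L :=
  scons (Var 0) (fun x => tsubst (fun y => Var y.+1) (s x)).

Fixpoint fsubst (s : nat -> term L) A : form L :=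
  match A with
  | Atom p a => Atom (fun i => tsubst s (a i))
  | And B C => And (fsubst s B) (fsubst s C)
  | Or B C => Or (fsubst s B) (fsubst s C)
  | Imp B C => Imp (fsubst s B) (fsubst s C)
  | All B => All (fsubst (up s) B)
  | Ex B => Ex (fsubst (up s) B)
  end.

(* A[t/x] for the matrix A of a quantified formula. *)
Definition inst A t : form L := fsubst (scons t Var) A.

Fixpoint tvar (x : nat) t : Prop :=
  match t with
  | Var y => x = y
  | App f a => exists i, tvar x (a i)
  end.

Fixpoint fvar (x : nat) A : Prop :=
  match A with
  | Atom p a => exists i, tvar x (a i)
  | And B C | Or B C | Imp B C => fvar x B \/ fvar x C
  | All B | Ex B => fvar x.+1 B
  end.

Record interp := Interp {
  dom : Type;
  dom_nonempty : inhabited dom;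
  fun_interp : forall f : fun_symbol L, ('I_(fun_arity f) -> dom) -> dom;
  rel_interp : forall p : rel_symbol L, ('I_(rel_arity p) -> dom) -> bool }.

Fixpoint teval (I : interp) (rho : nat -> dom I) t : dom I :=
  match t with
  | Var x => rho x
  | App f a => fun_interp (fun i => teval rho (a i))
  end.

Fixpoint sat (I : interp) (rho : nat -> dom I) A : bool :=
  match A with
  | Atom p a => rel_interp (fun i => teval rho (a i))
  | And B C => sat rho B && sat rho C
  | Or B C => sat rho B || sat rho C
  | Imp B C => sat rho B ==> sat rho C
  | All B => `[< forall d : dom I, sat (scons d rho) B >]
  | Ex B => `[< exists d : dom I, sat (scons d rho) B >]
  end.

Definition classically_valid A : Prop :=
  forall (I : interp) (rho : nat -> dom I), sat rho A.

End Syntax.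

(* A subformula occurrence of F is a Gentzen subformula of F with its position:
   the path to it from the root of F, last step first. The instances of one
   quantified formula share a position and differ by the formula. *)
Inductive step := Arg1 | Arg2 | Matrix.
Definition position := seq step.

Section Games.
Variable L : language.

Inductive symbol : Type :=
| Fm of position & form L
| QAnd1
| QAnd2
| QOr
| QAll of term L
| QEx.

Inductive kind := Att | Def.
Definition move : Type := (kind * symbol)%type.

(* A move together with the index of its image under the partial function f. *)
Definition entry : Type := (move * option nat)%type.

Implicit Types (G : seq entry) (e : entry) (A B F : form L) (p q : position).

Inductive is_attack : position -> form L -> symbol -> Prop :=
| AttImp p A B : is_attack p (Imp A B) (Fm (Arg1 :: p) A)
| AttAnd1 p A B : is_attack p (And A B) QAnd1
| AttAnd2 p A B : is_attack p (And A B) QAnd2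
| AttOr p A B : is_attack p (Or A B) QOr
| AttAll p A t : is_attack p (All A) (QAll t)
| AttEx p A : is_attack p (Ex A) QEx.

(* [is_defence p A s q B]: asserting B at q answers the attack s on A at p. *)
Inductive is_defence :
  position -> form L -> symbol -> position -> form L -> Prop :=
| DefImp p A B : is_defence p (Imp A B) (Fm (Arg1 :: p) A) (Arg2 :: p) B
| DefAnd1 p A B : is_defence p (And A B) QAnd1 (Arg1 :: p) A
| DefAnd2 p A B : is_defence p (And A B) QAnd2 (Arg2 :: p) B
| DefOr1 p A B : is_defence p (Or A B) QOr (Arg1 :: p) A
| DefOr2 p A B : is_defence p (Or A B) QOr (Arg2 :: p) B
| DefAll p A t : is_defence p (All A) (QAll t) (Matrix :: p) (inst A t)
| DefEx p A t : is_defence p (Ex A) QEx (Matrix :: p) (inst A t).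

Definition prejustified G : Prop :=
  forall n m k, onth G n = Some (m, Some k) -> k < n.

Definition enabled_by G (n k : nat) : Prop :=
  exists m, onth G n = Some (m, Some k).

(* Attacks by a formula and defences alike assert that formula. *)
Definition asserts G (n : nat) p A : Prop :=
  exists c f, onth G n = Some ((c, Fm p A), f).

Definition justified_attack G (n : nat) (s : symbol) (k : nat) p A : Prop :=
  [/\ onth G n = Some ((Att, s), Some k), asserts G k p A & is_attack p A s].

Definition justified_defence G (n : nat) q B (m : nat) : Prop :=
  onth G n = Some ((Def, Fm q B), Some m) /\
  exists s k p A, justified_attack G m s k p A /\ is_defence p A s q B.

Definition justified G (n : nat) : Prop :=
  (exists s k p A, justified_attack G n s k p A) \/
  (exists q B m, justified_defence G n q B m).

Definition reprise G (n : nat) : Prop :=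
  exists p A, asserts G n p A /\
    exists j q, [/\ j < n, odd j != odd n & asserts G j q A].

Definition atomic A : Prop := exists r a, A = @Atom L r a.

(* Finite games; an infinite one only matters as an infinite branch of a
   strategy, see [winning]. *)
Record game F G : Prop := Game {
  game_prejustified : prejustified G;
  game_start : onth G 0 = Some ((Def, Fm [::] F), None);
  game_justified : forall n, 0 < n < size G -> justified G n;
  game_O_enabler : forall n, n < size G -> odd n -> enabled_by G n n.-1;
  game_P_enabler : forall n, 2 <= n < size G -> ~~ odd n ->
    exists k, odd k /\ enabled_by G n k;
  game_atomic : forall n p A, ~~ odd n -> asserts G n p A -> atomic A ->
    reprise G n;
  game_no_repeat : forall m n p A k, ~~ odd m -> ~~ odd n ->
    onth G m = Some ((Def, Fm p A), Some k) ->
    onth G n = Some ((Def, Fm p A), Some k) -> m = n }.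

Definition legal F G e : Prop := game F (rcons G e).

(* The last move of G has index (size G).-1. *)
Definition won_by_P F G : Prop :=
  [/\ game F G, odd (size G) & forall e, ~ legal F G e].

Definition appears G (x : nat) : Prop :=
  (exists n p A, asserts G n p A /\ fvar x A) \/
  (exists n t f, onth G n = Some ((Att, QAll t), f) /\ tvar x t).

Definition first_fresh (enum : nat -> nat) G (x : nat) : Prop :=
  exists n, [/\ enum n = x, ~ appears G x & forall m, m < n -> appears G (enum m)].

Definition universal_attack e t : Prop := e.1 = (Att, QAll t).
Definition existential_attack e : Prop := e.1 = (Att, QEx).
Definition asserts_universal e : Prop := exists p A, e.1.2 = Fm p (All A).

(* The move e, to be appended to G, is an existential defence with term t. *)
Definition existential_defence G e t : Prop :=
  exists m k p A, justified_attack G m QEx k p (Ex A) /\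
    e = ((Def, Fm (Matrix :: p) (inst A t)), Some m).

(* The next move after G has index [size G], so it is a P-move when [size G] is
   even, and an O-move when [size G] is odd.

   [strat_unskipped] makes explicit that the relaxation of [strat_O_moves] is
   only about which term O chooses. When P attacks [Imp (All A) B] by asserting
   [All A], O may attack [All A] or defend with B, and both have to be
   considered. Otherwise P would win on [Imp (Imp (All A) B) B] for any A and
   any atom B, by leaving out the attack on [All A]. *)
Record strategy (enum : nat -> nat) F (S : seq entry -> Prop) : Prop := Strategy {
  strat_games : forall G, S G -> game F G;
  strat_nonempty : exists G, S G;
  strat_prefix : forall G H, G <> [::] -> S (G ++ H) -> S G;
  strat_O_moves : forall G a e, ~~ odd (size G) -> S (rcons G a) ->
    ~ asserts_universal a -> ~ existential_attack a ->
    legal F (rcons G a) e -> S (rcons (rcons G a) e);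
  strat_unskipped : forall G a, ~~ odd (size G) -> S (rcons G a) ->
    a.1.1 = Att -> asserts_universal a ->
    (forall e, e.1.1 = Def -> legal F (rcons G a) e ->
      S (rcons (rcons G a) e)) /\
    (exists e t, universal_attack e t /\ S (rcons (rcons G a) e));
  strat_P_unique : forall G e e', ~~ odd (size G) ->
    S (rcons G e) -> S (rcons G e') -> e = e';
  strat_universal_unique : forall G e e' t t', odd (size G) ->
    S (rcons G e) -> S (rcons G e') ->
    universal_attack e t -> universal_attack e' t' -> e = e';
  strat_universal_fresh : forall G e t, odd (size G) ->
    S (rcons G e) -> universal_attack e t ->
    exists x, first_fresh enum G x /\ t = Var x;
  strat_existential_unique : forall G e e' t t', odd (size G) ->
    S (rcons G e) -> S (rcons G e') ->
    existential_defence G e t -> existential_defence G e' t' -> e = e';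
  (* The term is not part of a defence, and e determines it only if the
     quantifier is not vacuous. *)
  strat_existential_fresh : forall G e t, odd (size G) ->
    S (rcons G e) -> existential_defence G e t ->
    exists x, first_fresh enum G x /\ existential_defence G e (Var x);
  strat_P_existential : forall G a, odd (size G) -> S (rcons G a) ->
    existential_attack a ->
    exists e t, S (rcons (rcons G a) e) /\
      existential_defence (rcons G a) e t /\ e.2 = Some (size G) }.

(* S being prefix-closed, a maximal branch is either the set of prefixes of a
   game that S does not extend, or infinite, hence not won by P. *)
Definition winning F (S : seq entry -> Prop) : Prop :=
  (forall G, S G -> (forall e, ~ S (rcons G e)) -> won_by_P F G) /\
  (forall b : nat -> entry, ~ forall n, S (mkseq b n.+1)).

Definition dialogically_valid (enum : nat -> nat) F : Prop :=
  exists S, strategy enum F S /\ winning F S.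

End Games.

(* Main.v *)
(** Soundness: if F is false in some interpretation, O follows the strategy
    while asserting only true formulas, attacking only false ones, and giving
    each fresh variable the value it needs. P then never gets to assert a true
    formula in defence, in particular no atom already asserted by O, so the
    play never stops.

    Completeness: otherwise P has no winning position at the start, and O can
    move from lost position to lost position against a P who runs fairly
    through all possible moves. The limit of this play describes a Herbrand
    model in which all assertions of O are true and all formulas attacked by O
    are false, among them F. The obstacle to fairness is the rule that P
    answers an existential attack at once: asserting a block of existential
    quantifiers over an atom is suicidal unless O has already asserted an
    instance of that atom. P therefore waits for one; if none ever comes, the
    formula is false in the Herbrand model anyway. *)

Require Import Defs.
From mathcomp Require Import all_boot.
From mathcomp Require Import boolp.

Set Implicit Arguments.
Unset Strict Implicit.
Unset Printing Implicit Defensive.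

(** * Substitution and evaluation *)

Section Substitution.
Variable L : language.
Implicit Types (s : nat -> term L) (t : term L) (A B : form L).

Lemma scons_comp (T U : Type) (f : T -> U) a (s : nat -> T) :
  (fun x => f (scons a s x)) = scons (f a) (fun x => f (s x)).
Proof. by apply: funext => -[]. Qed.

Lemma tsubst_Var t : tsubst Var t = t.
Proof. by elim: t => //= f a IH; congr App; apply: funext. Qed.

Lemma tsubst_comp s s' t :
  tsubst s' (tsubst s t) = tsubst (fun x => tsubst s' (s x)) t.
Proof. by elim: t => //= f a IH; congr App; apply: funext. Qed.

Lemma up_comp s s' :
  (fun x => tsubst (up s') (up s x)) = up (fun x => tsubst s' (s x)).
Proof.
apply: funext => -[|x] //=; rewrite !tsubst_comp; congr (tsubst _ (s x)).
Qed.

Lemma up_Var : up Var = Var :> (nat -> term L).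
Proof. by apply: funext => -[]. Qed.

Lemma fsubst_Var A : fsubst Var A = A.
Proof.
elim: A => //= [p a|A -> B ->|A -> B ->|A -> B ->|A IH|A IH] //; rewrite ?up_Var ?IH //.
by congr Atom; apply: funext => i; rewrite tsubst_Var.
Qed.

Lemma fsubst_comp s s' A :
  fsubst s' (fsubst s A) = fsubst (fun x => tsubst s' (s x)) A.
Proof.
elim: A s s' => /= [p a|A IA B IB|A IA B IB|A IA B IB|A IA|A IA] s s';
  rewrite ?IA ?IB ?up_comp //.
by congr Atom; apply: funext => i; rewrite tsubst_comp.
Qed.

(** Instantiation after a substitution merges with it into one extended substitution, so that
    inductions in the Herbrand model can pass a quantifier by extending the environment. *)
Lemma inst_fsubst s A t : inst (fsubst (up s) A) t = fsubst (scons t s) A.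
Proof.
rewrite /inst fsubst_comp; congr fsubst; apply: funext => -[|x] //=.
by rewrite tsubst_comp /= tsubst_Var.
Qed.

Lemma teval_tsubst (I : interp L) (rho : nat -> dom I) s t :
  teval rho (tsubst s t) = teval (fun x => teval rho (s x)) t.
Proof. by elim: t => //= f a IH; congr fun_interp; apply: funext. Qed.

Lemma sat_fsubst (I : interp L) (rho : nat -> dom I) s A :
  sat rho (fsubst s A) = sat (fun x => teval rho (s x)) A.
Proof.
have upE d (r : nat -> dom I) s' :
    (fun x => teval (scons d r) (up s' x)) = scons d (fun x => teval r (s' x)).
  by apply: funext => -[|x] //=; rewrite teval_tsubst.
elim: A rho s => /= [p a|A IA B IB|A IA B IB|A IA B IB|A IA|A IA] rho s;
  rewrite ?IA ?IB //.
- by congr rel_interp; apply: funext => i; rewrite teval_tsubst.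
- by apply: asbool_equiv_eq; split=> H d; have:= H d; rewrite IA upE.
- by apply: asbool_equiv_eq; split=> -[d H]; exists d; move: H; rewrite IA upE.
Qed.

Lemma sat_inst (I : interp L) (rho : nat -> dom I) A t :
  sat rho (inst A t) = sat (scons (teval rho t) rho) A.
Proof. by rewrite sat_fsubst scons_comp. Qed.

Lemma teval_ext (I : interp L) (rho rho' : nat -> dom I) t :
  (forall x, tvar x t -> rho x = rho' x) -> teval rho t = teval rho' t.
Proof.
elim: t => /= [x|f a IH] H; first exact: H.
by congr fun_interp; apply: funext => i; apply: IH => x xi; apply: H; exists i.
Qed.

Lemma sat_ext (I : interp L) (rho rho' : nat -> dom I) A :
  (forall x, fvar x A -> rho x = rho' x) -> sat rho A = sat rho' A.
Proof.
elim: A rho rho' => /= [p a|A IA B IB|A IA B IB|A IA B IB|A IA|A IA] rho rho' H.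
- congr rel_interp; apply: funext => i; apply: teval_ext => x xi.
  by apply: H; exists i.
- by rewrite (IA _ rho') ?(IB _ rho') // => x ?; apply: H; [right|left].
- by rewrite (IA _ rho') ?(IB _ rho') // => x ?; apply: H; [right|left].
- by rewrite (IA _ rho') ?(IB _ rho') // => x ?; apply: H; [right|left].
- have E d : sat (scons d rho) A = sat (scons d rho') A.
    by apply: IA => -[|x] //=; apply: H.
  by apply: asbool_equiv_eq; split=> + d => /(_ d); rewrite E.
- have E d : sat (scons d rho) A = sat (scons d rho') A.
    by apply: IA => -[|x] //=; apply: H.
  by apply: asbool_equiv_eq; split=> -[d]; exists d; rewrite ?E // -E.
Qed.

Lemma tvar_bounded t : exists N, forall x, tvar x t -> x < N.
Proof.
elim: t => /= [x|f a IH]; first by exists x.+1 => y ->.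
have [N HN] := choice IH.
exists (\max_i N i) => x [i /HN lt_x].
by apply: leq_trans lt_x _; apply: leq_bigmax.
Qed.

Lemma fvar_bounded A : exists N, forall x, fvar x A -> x < N.
Proof.
elim: A => /= [p a|A [m Hm] B [n Hn]|A [m Hm] B [n Hn]|A [m Hm] B [n Hn]
  |A [m Hm]|A [m Hm]].
- have [N HN] := choice (fun i => tvar_bounded (a i)).
  exists (\max_i N i) => x [i /HN lt_x].
  by apply: leq_trans lt_x _; apply: leq_bigmax.
- by exists (maxn m n) => x; rewrite leq_max => -[/Hm|/Hn] ->; rewrite ?orbT.
- by exists (maxn m n) => x; rewrite leq_max => -[/Hm|/Hn] ->; rewrite ?orbT.
- by exists (maxn m n) => x; rewrite leq_max => -[/Hm|/Hn] ->; rewrite ?orbT.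
- by exists m => x /Hm/ltnW.
- by exists m => x /Hm/ltnW.
Qed.

End Substitution.

(** * Legal moves *)

Section Positions.
Variable L : language.
Implicit Types (G H : seq (entry L)) (e a : entry L) (A B F : form L).

Lemma onth_rcons G e n :
  onth (rcons G e) n =
  if n < size G then onth G n else if n == size G then Some e else None.
Proof.
rewrite -cats1 onth_cat; case: ltngtP => // lt.
  by rewrite onth_default // subn_gt0.
by rewrite lt subnn.
Qed.

Lemma onth_rcons_last G e : onth (rcons G e) (size G) = Some e.
Proof. by rewrite onth_rcons ltnn eqxx. Qed.

Lemma onth_lt G n e : onth G n = Some e -> n < size G.
Proof. by rewrite -onthTE => ->. Qed.

Definition extends G H := forall n e, onth G n = Some e -> onth H n = Some e.

Lemma extends_rcons G e : extends G (rcons G e).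
Proof. by move=> n x E; rewrite onth_rcons (onth_lt E). Qed.

Lemma extends_trans G H K : extends G H -> extends H K -> extends G K.
Proof. by move=> GH HK n e /GH/HK. Qed.

Lemma asserts_lt G n p A : asserts G n p A -> n < size G.
Proof. by move=> [c [f /onth_lt]]. Qed.

Lemma asserts_ext G H n p A : extends G H -> asserts G n p A -> asserts H n p A.
Proof. by move=> GH [c [f /GH E]]; exists c, f. Qed.

Lemma asserts_rcons G e n p A :
  n < size G -> asserts (rcons G e) n p A -> asserts G n p A.
Proof. by move=> lt [c [f]]; rewrite onth_rcons lt => E; exists c, f. Qed.

Lemma asserts_last G e p A : e.1.2 = Fm p A -> asserts (rcons G e) (size G) p A.
Proof. by case: e => -[c s] f /= ->; exists c, f; rewrite onth_rcons_last. Qed.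

Lemma asserts_lastE G e p A :
  asserts (rcons G e) (size G) p A -> e.1.2 = Fm p A.
Proof. by move=> [c [f]]; rewrite onth_rcons_last => -[->]. Qed.

Lemma asserts_inj G n p A q B :
  asserts G n p A -> asserts G n q B -> p = q /\ A = B.
Proof. by move=> [c [f E]] [c' [f']]; rewrite E => -[_ -> ->]. Qed.

Lemma justified_attack_ext G H n s k p A :
  extends G H -> justified_attack G n s k p A -> justified_attack H n s k p A.
Proof. by move=> GH [/GH E /(asserts_ext GH)]. Qed.

Lemma justified_attack_inj G n s k p A s' k' p' A' :
  justified_attack G n s k p A -> justified_attack G n s' k' p' A' ->
  [/\ s = s', k = k', p = p' & A = A'].
Proof.
by move=> [E a1 _] []; rewrite E => -[<- <-] /(asserts_inj a1)[].
Qed.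

Lemma justified_attack_rcons G e n s k p A : prejustified (rcons G e) ->
  n < size G -> justified_attack (rcons G e) n s k p A ->
  justified_attack G n s k p A.
Proof.
move=> pj lt [E a1 a2]; have lt_k := pj _ _ _ E; split=> //.
  by move: E; rewrite onth_rcons lt.
by apply: asserts_rcons a1; apply: ltn_trans lt.
Qed.

(** Justification freed from the index of the justified move, so that it also applies to a move
    still to be played. [justifiedP] relates the two forms. *)
Variant answers G : move L -> nat -> Prop :=
| AnswerAttack s k p A of asserts G k p A & is_attack p A s :
    answers G (Att, s) k
| AnswerDefence q B k s j p A of justified_attack G k s j p A
    & is_defence p A s q B : answers G (Def, Fm q B) k.

Lemma answers_attack G s k :
  answers G (Att, s) k -> exists p A, asserts G k p A /\ is_attack p A s.
Proof.
move E: (Att, s) => m an; case: an E => // s' {}k p A a1 a2 [->].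
by exists p, A.
Qed.

Lemma answers_defence G r k : answers G (Def, r) k ->
  exists q B s j p A,
    [/\ r = Fm q B, justified_attack G k s j p A & is_defence p A s q B].
Proof.
move E: (Def, r) => m an; case: an E => // q B {}k s j p A a1 a2 [->].
by exists q, B, s, j, p, A.
Qed.

Lemma answers_ext G H m k : extends G H -> answers G m k -> answers H m k.
Proof.
move=> GH [s k' p A a1 a2|q B k' s j p A a1 a2].
  by apply: AnswerAttack a2; apply: asserts_ext a1.
by apply: AnswerDefence a2; apply: justified_attack_ext a1.
Qed.

Lemma answers_lt G m k : answers G m k -> k < size G.
Proof. by case=> [s {}k p A /asserts_lt|q B {}k s j p A [/onth_lt]]. Qed.

Lemma answers_rcons G e m k : prejustified (rcons G e) -> k < size G ->
  answers (rcons G e) m k -> answers G m k.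
Proof.
move=> pj lt an; case: an lt => [s {}k p A a1 a2|q B {}k s j p A a1 a2] lt.
  by apply: AnswerAttack a2; apply: asserts_rcons a1.
by apply: AnswerDefence a2; apply: justified_attack_rcons a1.
Qed.

Lemma justifiedP G n : justified G n <->
  exists m k, onth G n = Some (m, Some k) /\ answers G m k.
Proof.
split=> [[[s [k [p [A [E a1 a2]]]]]|[q [B [m [E [s [k [p [A [a1 a2]]]]]]]]]]|].
- by exists (Att, s), k; split=> //; exact: AnswerAttack a1 a2.
- by exists (Def, Fm q B), m; split=> //; exact: AnswerDefence a1 a2.
move=> [m [k [E an]]]; case: an E => [s {}k p A a1 a2|q B {}k s j p A a1 a2] E.
  by left; exists s, k, p, A.
by right; exists q, B, k; split=> //; exists s, j, p, A.
Qed.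

(** The position is forgotten because a reprise only compares formulas. *)
Definition opponent_asserts G A := exists k p, odd k /\ asserts G k p A.

Lemma opponent_asserts_ext G H A :
  extends G H -> opponent_asserts G A -> opponent_asserts H A.
Proof. by move=> GH [k [p [ok /(asserts_ext GH)]]]; exists k, p. Qed.

(** The demands of the rules on one appended move. An entry carries its position, formula and
    enabler, so equality of entries is exactly the coincidence that the rule against repeated
    defences forbids. *)
Record admissible G e : Prop := Admissible {
  adm_answer : exists k, [/\ e.2 = Some k,
    if odd (size G) then k = (size G).-1 else odd k & answers G e.1 k];
  adm_atomic : ~~ odd (size G) -> forall p A, e.1.2 = Fm p A -> atomic A ->
    opponent_asserts G A;
  adm_new : ~~ odd (size G) -> e.1.1 = Def -> forall m, ~~ odd m ->
    onth G m <> Some e }.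

Lemma game_size F G : game F G -> 0 < size G.
Proof. by move=> /game_start/onth_lt. Qed.

(** No rule looks beyond the moves it constrains, so all of them pass to a prefix that still
    contains the initial move. *)
Lemma game_rcons F G e : 0 < size G -> game F (rcons G e) -> game F G.
Proof.
move=> G0 [pj st ju oe pe at_ nr].
have ext := @extends_rcons G e.
have back n x : onth (rcons G e) n = Some x -> n < size G -> onth G n = Some x.
  by rewrite onth_rcons => + lt; rewrite lt.
split.
- by move=> n m k /ext/pj.
- exact: back.
- move=> n /andP[n0 lt]; apply/justifiedP.
  have /justifiedP[m [k [E an]]] : justified (rcons G e) n.
    by apply: ju; rewrite n0 size_rcons ltnW.
  exists m, k; split; first exact: back.
  by apply: answers_rcons an => //; apply: ltn_trans lt; apply: pj E.
- move=> n lt on; have [|//|m E] := oe n; first by rewrite size_rcons ltnW.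
  by exists m; apply: back.
- move=> n /andP[n2 lt] en; have [|//|k [ok [m E]]] := pe n.
    by rewrite n2 size_rcons ltnW.
  by exists k; split=> //; exists m; apply: back.
- move=> n p A en an aA; have lt := asserts_lt an.
  have [q [B [a1 [j [r [ltj jn a2]]]]]] := at_ n p A en (asserts_ext ext an) aA.
  exists q, B; split; first exact: asserts_rcons a1.
  by exists j, r; split=> //; apply: asserts_rcons a2; apply: ltn_trans lt.
- by move=> m n p A k em en /ext Em /ext En; apply: nr Em En.
Qed.

(** The clauses about old moves hold before and after appending [e], so legality depends on the new
    move alone. *)
Lemma legalP F G e : game F G -> legal F G e <-> admissible G e.
Proof.
move=> gG; have G0 := game_size gG; have ext := @extends_rcons G e.
split=> [gGe|[[k [e2 ek an]] at_ nr]].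
  have lt : size G < size (rcons G e) by rewrite size_rcons.
  have pj := game_prejustified gGe.
  have /justifiedP[m [k [E an]]] : justified (rcons G e) (size G).
    by apply: (game_justified gGe); rewrite G0.
  have ltk := pj _ _ _ E.
  move: E; rewrite onth_rcons_last => -[Ee].
  split.
  - exists k; rewrite Ee; split=> //; last exact: answers_rcons an.
    case: ifP => oG.
      have [m' ] := game_O_enabler gGe lt oG.
      by rewrite onth_rcons_last Ee => -[].
    have [||k' [ok' [m']]] := game_P_enabler gGe (n := size G); rewrite ?oG //.
      by rewrite lt andbT; case: (size G) G0 oG => [|[]].
    by rewrite onth_rcons_last Ee => -[_ ->].
  - move=> eG p A Ep aA.
    have [q [B [a1 [j [r [ltj jn a2]]]]]] :=
      game_atomic gGe eG (asserts_last G Ep) aA.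
    have [_ AB] := asserts_inj a1 (asserts_last G Ep).
    exists j, r; split; last by rewrite -AB; apply: asserts_rcons ltj a2.
    by move: jn; rewrite (negbTE eG); case: odd.
  - move=> eG eD n en E.
    (* A copy of [e] at index [n] and [e] itself at index [size G] would have to be the same
       move. *)
    have lt' := onth_lt E.
    case: an Ee eD => [? ? ? ? _ _ -> //|q B k' s j p A _ _ Ee _].
    have En := ext _ _ E; rewrite {2}Ee in En.
    have := game_no_repeat gGe en eG En; rewrite onth_rcons_last {1}Ee.
    by move=> /(_ erefl) nG; rewrite nG ltnn in lt'.
have ltk := answers_lt an.
have [pj st ju oe pe at0 nr0] := gG.
have back n x : onth (rcons G e) n = Some x ->
    onth G n = Some x \/ n = size G /\ x = e.
  by rewrite onth_rcons; case: ifP => [_|_]; [left|case: eqP => // -> [<-]; right].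
have sz n : n < size (rcons G e) -> n < size G \/ n = size G.
  by rewrite size_rcons ltnS leq_eqVlt => /predU1P[->|]; [right|left].
split.
- move=> n m j /back[/pj //|[-> E]].
  by move: e2; rewrite -E => -[->].
- exact: ext.
- move=> n /andP[n0 /sz[lt|->]]; apply/justifiedP.
    have /justifiedP[m [j [E an']]] : justified G n by apply: ju; rewrite n0.
    by exists m, j; split; [apply: ext|apply: answers_ext an'].
  exists e.1, k; rewrite onth_rcons_last -e2; split; first by case: (e).
  exact: answers_ext an.
- move=> n /sz[lt|->] on.
    by have [m /ext E] := oe n lt on; exists m.
  by exists e.1; rewrite onth_rcons_last; move: ek; rewrite on => <-; rewrite -e2; case: (e).
- move=> n /andP[n2 /sz[lt|nE]] en.
    have [||j [oj [m /ext E]]] := pe n => //; first by rewrite n2.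
    by exists j; split=> //; exists m.
  subst n; rewrite (negbTE en) in ek.
  by exists k; split=> //; exists e.1; rewrite onth_rcons_last -e2; case: (e).
- move=> n p A en an' aA; have := asserts_lt an' => /sz[lt|nE].
    have [q [B [a1 [j [r [ltj jn a2]]]]]] := at0 n p A en (asserts_rcons lt an') aA.
    exists q, B; split; first exact: asserts_ext a1.
    by exists j, r; split=> //; apply: asserts_ext a2.
  subst n; have Ep := asserts_lastE an'.
  have [j [r [oj a2]]] := at_ en _ _ Ep aA.
  exists p, A; split=> //; exists j, r; split; first exact: asserts_lt a2.
    by rewrite oj; case: odd en.
  exact: asserts_ext a2.
- move=> m n p A j em en /back[Em|[mE Em]] /back[En|[nE En]].
  + exact: nr0 Em En.
  + by subst n e; case: (nr en erefl m em).
  + by subst m e; case: (nr em erefl n en).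
  + by rewrite mE.
Qed.

(** The initial move has even index: an atomic [F] would have to be a reprise, with nothing before
    it. *)
Lemma game_single F : ~ atomic F -> game F [:: ((Def, Fm [::] F), None)].
Proof.
move=> nF; have one n : 0 < n -> onth [:: ((Def, Fm [::] F), None) : entry L] n = None.
  by move=> n0; rewrite onth_default.
split.
- by case=> [//|n] m k; rewrite one.
- by [].
- by move=> [|[|n]].
- by case.
- by case=> [|[]].
- move=> [|n] p A _ [c [f]]; last by rewrite one.
  by move=> -[_ _ <- _] /nF.
- by move=> [|m] [|n] p A k _ _ //; rewrite ?(one m.+1) ?(one n.+1).
Qed.

Lemma legal_O_answer F G a e : game F (rcons G a) -> ~~ odd (size G) ->
  legal F (rcons G a) e ->
  e.2 = Some (size G) /\ answers (rcons G a) e.1 (size G).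
Proof.
move=> g eG /(legalP _ g) [[k []]]; rewrite size_rcons /= eG => -> -> an _ _.
by split.
Qed.

(** The rules on atoms and on repeated defences bind P only, so O may play any answer to the last
    move. *)
Lemma legal_O F G a m : game F (rcons G a) -> ~~ odd (size G) ->
  answers (rcons G a) m (size G) -> legal F (rcons G a) (m, Some (size G)).
Proof.
move=> g eG an; apply/(legalP _ g); split; rewrite ?size_rcons /= ?eG //.
by exists (size G).
Qed.

Lemma legal_P_answer F G e : game F G -> ~~ odd (size G) -> legal F G e ->
  exists k, [/\ e.2 = Some k, odd k & answers G e.1 k].
Proof.
by move=> g /negbTE eG /(legalP _ g)[[k []]]; rewrite eG => ? ? ? _ _; exists k.
Qed.

(** * Fresh variables *)

Lemma appears_bounded G : exists N, forall x, appears G x -> x < N.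
Proof.
have ex (n : nat) : exists N, forall x,
    (exists p A, asserts G n p A /\ fvar x A) \/
    (exists t f, onth G n = Some ((Att, QAll t), f) /\ tvar x t) -> x < N.
  case E: (onth G n) => [[[c s] f]|]; last first.
    by exists 0 => x [[p [A [[c [f E']] _]]]|[t [f [E' _]]]]; rewrite E' in E.
  case: s E => [p A|||| t|] E; try by exists 0 => x
    [[q [B [[c' [f' E']] _]]]|[t [f' [E' _]]]]; rewrite E' in E.
    have [N HN] := fvar_bounded A; exists N => x.
    move=> [[q [B [[c' [f' E']] Hx]]]|[t [f' [E' _]]]]; move: E; rewrite E' //.
    by case=> _ _ AE _; apply: HN; rewrite -AE.
  have [N HN] := tvar_bounded t; exists N => x.
  move=> [[q [B [[c' [f' E']] _]]]|[t' [f' [E' Hx]]]]; move: E; rewrite E' //.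
  by case: E' => _ tE _ _; apply: HN; rewrite tE.
have [N HN] := choice ex.
exists (\max_(n < size G) N n) => x ap.
have [n [ltn Hn]] : exists n, n < size G /\ x < N n.
  case: ap => [[n [p [A [a1 a2]]]]|[n [t [f [a1 a2]]]]]; exists n; split.
  - exact: asserts_lt a1.
  - by apply: HN; left; exists p, A.
  - exact: onth_lt a1.
  - by apply: HN; right; exists t, f.
by apply: leq_trans Hn _; apply: (leq_bigmax (Ordinal ltn)).
Qed.

Variable en : nat -> nat.

(** The variables appearing in a finite game are bounded, and a surjective enumeration lists some
    variable above the bound. *)
Lemma first_fresh_exists G :
  (forall x, exists n, en n = x) -> exists x, first_fresh en G x.
Proof.
move=> sur; have [N HN] := appears_bounded G; have [n0 En0] := sur N.
have ex : exists n, `[< ~ appears G (en n) >].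
  by exists n0; apply/asboolP => /HN; rewrite En0 ltnn.
case: (ex_minnP ex) => n /asboolP nap mn.
exists (en n), n; split=> // m ltm; apply: contrapT => /asboolP/mn.
by rewrite leqNgt ltm.
Qed.

Lemma first_fresh_inj G x y : first_fresh en G x -> first_fresh en G y -> x = y.
Proof.
move=> [m [<- nm lm]] [n [<- nn ln]].
by case: (ltngtP m n) => [/ln|/lm|->].
Qed.

End Positions.

(** * Soundness *)

Section Soundness.
Variable L : language.
Implicit Types (G H : seq (entry L)) (e a : entry L) (A B F : form L).

Lemma is_attackE p A (s : symbol L) : is_attack p A s ->
  match A with
  | Atom _ _ => False
  | And _ _ => s = QAnd1 L \/ s = QAnd2 L
  | Or _ _ => s = QOr L
  | Imp B _ => s = Fm (Arg1 :: p) B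
  | All _ => exists t, s = QAll t
  | Ex _ => s = QEx L
  end.
Proof. by case=> *; auto; eexists. Qed.

(** * The invariant that O keeps in a falsifying interpretation *)

Section Falsification.
Variable I : interp L.
Implicit Types rho : nat -> dom I.
Variable F0 : form L.

(** The attack [s] leaves only false defences of [A]. For an implication the truth of the antecedent
    is not recorded here: the attack asserts it, so [true_O] takes care of it. *)
Definition refuted rho A (s : symbol L) : bool :=
  match A, s with
  | Imp _ B, Fm _ _ => ~~ sat rho B
  | And B _, QAnd1 => ~~ sat rho B
  | And _ B, QAnd2 => ~~ sat rho B
  | Or _ _, QOr => ~~ sat rho A
  | All B, QAll t => ~~ sat rho (inst B t)
  | Ex _, QEx => ~~ sat rho A
  | _, _ => true
  end.

Lemma refuted_defence rho p A s q B :
  is_defence p A s q B -> refuted rho A s -> ~~ sat rho B.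
Proof.
case=> {p A s q B} [p A B|p A B|p A B|p A B|p A B|p A t|p A t] //=.
- by rewrite negb_or => /andP[].
- by rewrite negb_or => /andP[].
- move=> /asboolPn nex; apply/negP; rewrite sat_inst => sA; apply: nex.
  by exists (teval rho t).
Qed.

Lemma refuted_ext rho rho' p A s : is_attack p A s ->
  (forall x, fvar x A -> rho x = rho' x) ->
  (forall t x, s = QAll t -> tvar x t -> rho x = rho' x) ->
  refuted rho A s = refuted rho' A s.
Proof.
case=> {p A s} [p A B|p A B|p A B|p A B|p A t|p A] EA Es;
  rewrite /refuted; congr (~~ _); try by apply: sat_ext => x Hx; apply: EA;
    rewrite /= ?Hx; auto.
rewrite !sat_inst; apply: sat_ext => -[|x] /= Hx; last exact: EA.
by apply: teval_ext => x /Es; apply.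
Qed.

(** Falsity is required of P's defences only. A formula that P asserts as an attack may be true, in
    which case O defends instead of attacking it. *)
Record truthful G rho : Prop := Truthful {
  true_O : forall k p A, odd k -> asserts G k p A -> sat rho A;
  refuted_P : forall m s k p A, odd m -> justified_attack G m s k p A ->
    refuted rho A s;
  false_P : forall n p A f, ~~ odd n -> onth G n = Some ((Def, Fm p A), f) ->
    ~~ sat rho A }.

Definition update rho x d : nat -> dom I := fun y => if y == x then d else rho y.

(** All formulas and attacks in the invariant depend only on variables that appear in [G], among
    them those of the terms in universal attacks. *)
Lemma truthful_update G rho x d :
  ~ appears G x -> truthful G rho -> truthful G (update rho x d).
Proof.
move=> nx [tO rP fP].
have upd y : appears G y -> rho y = update rho x d y.
  by rewrite /update; case: eqP => // ->.
split.
- move=> k p A ok a1; rewrite -(sat_ext (rho := rho)); first exact: tO a1.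
  by move=> y Hy; apply: upd; left; exists k, p, A.
- move=> m s k p A om ja; have [E a1 a2] := ja.
  rewrite -(refuted_ext (rho := rho) a2); first exact: rP ja.
    by move=> y Hy; apply: upd; left; exists k, p, A.
  move=> t y Es Hy; apply: upd; right; exists m, t, (Some k); by rewrite -Es.
- move=> n p A f en E; rewrite -(sat_ext (rho := rho)); first exact: fP E.
  by move=> y Hy; apply: upd; left; exists n, p, A; split=> //; exists Def, f.
Qed.

(** The eigenvariable argument: a variable not free in the quantified formula can be made to name
    [d]. The condition reads the same for [All A] and [Ex A], so this serves both quantifiers. *)
Lemma sat_update rho x d A :
  ~ fvar x (All A) -> sat (scons d rho) A = sat (update rho x d) (inst A (Var x)).
Proof.
move=> nx; rewrite sat_inst /= /update eqxx; apply: sat_ext => -[|y] //= Hy.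
by case: eqP => // yx; case: nx; rewrite -yx.
Qed.

(** P cannot break the invariant: a defence of P answers an attack of O, which was chosen so that
    all its defences are false. *)
Lemma truthful_P F G e rho : game F G -> ~~ odd (size G) -> legal F G e ->
  truthful G rho -> truthful (rcons G e) rho.
Proof.
move=> gG eG le [tO rP fP]; have pj := game_prejustified le.
have lt k : odd k -> k < size (rcons G e) -> k < size G.
  rewrite size_rcons ltnS leq_eqVlt => ok /predU1P[kE|//].
  by rewrite kE (negbTE eG) in ok.
split.
- move=> k p A ok a1; apply: (tO k p A ok); apply: asserts_rcons (a1).
  by apply: lt => //; apply: asserts_lt a1.
- move=> m s k p A om ja; apply: (rP m s k p A om).
  apply: justified_attack_rcons (ja) => //; apply: lt => //.
  by case: ja => /onth_lt.
- move=> n p A f en; rewrite onth_rcons; case: ifP => [_|_]; first exact: fP.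
  case: eqP => // _ [Ee].
  have [k [_ ok]] := legal_P_answer gG eG le.
  rewrite Ee => /answers_defence[q [B [s [j [p' [A' [[_ ->] ja df]]]]]]].
  exact: refuted_defence df (rP _ _ _ _ _ ok ja).
Qed.

Lemma truthful_O G a e rho : ~~ odd (size G) ->
  game F0 (rcons (rcons G a) e) -> truthful (rcons G a) rho ->
  (forall p A, e.1.2 = Fm p A -> sat rho A) ->
  (forall s p A, e.1 = (Att, s) -> a.1.2 = Fm p A -> is_attack p A s ->
    refuted rho A s) ->
  truthful (rcons (rcons G a) e) rho.
Proof.
move=> eG gGe [tO rP fP] te re; have pj := game_prejustified gGe.
have sz : size (rcons G a) = (size G).+1 by rewrite size_rcons.
have gG : game F0 (rcons G a) by apply: game_rcons gGe; rewrite sz.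
have [e2 _] := legal_O_answer gG eG gGe.
have last n : n < size (rcons (rcons G a) e) ->
    n < size (rcons G a) \/ n = size (rcons G a).
  by rewrite (size_rcons _ e) ltnS leq_eqVlt => /predU1P[|]; [right|left].
split.
- move=> k p A ok a1; have [lt|kE] := last k (asserts_lt a1).
    by apply: (tO k p A ok); apply: asserts_rcons a1.
  by rewrite kE in a1; apply: te (asserts_lastE a1).
- move=> m s k p A om ja; have [E a1 a2] := ja; have [lt|mE] := last m (onth_lt E).
    by apply: (rP m s k p A om); apply: justified_attack_rcons ja.
  move: E; rewrite mE onth_rcons_last => -[Ee].
  apply: (re _ p A _ _ a2); first by rewrite Ee.
  (* The enabler of the new O-move is [a], so the attacked formula is the one that [a] asserts. *)
  move: e2 a1; rewrite Ee => -[->] a1; apply: (asserts_lastE (G := G)).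
  by apply: asserts_rcons a1; rewrite sz.
- move=> n p A f en E; have [lt|nE] := last n (onth_lt E).
    by apply: (fP n p A f en); move: E; rewrite onth_rcons lt.
  by rewrite nE sz /= negbK (negbTE eG) in en.
Qed.

(** * Playing O against a winning strategy *)

Variables (en : nat -> nat) (S : seq (entry L) -> Prop).
Hypotheses (str : strategy en F0 S) (win : winning F0 S).

(* No clause of [strategy] makes S contain an attack on a universal defence or
   an answer to P's existential attack; S has one because a branch that ends
   while O can move is not won by P. *)
Lemma strategy_extends G e : S G -> legal F0 G e -> exists e', S (rcons G e').
Proof.
move=> SG le; apply: contrapT => /forallNP nS.
by have [_ _ /(_ e)] := win.1 G SG nS.
Qed.

Lemma strategy_P_move G : S G -> ~~ odd (size G) -> exists e, S (rcons G e).
Proof.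
move=> SG eG; apply: contrapT => /forallNP nS.
by have [_ oG _] := win.1 G SG nS; rewrite oG in eG.
Qed.

(** The valuation is quantified anew for each game because O revises it at fresh variables. *)
Definition on_course G := S G /\ exists rho, truthful G rho.

Section Response.
Variables (G : seq (entry L)) (a : entry L) (rho : nat -> dom I).
Hypotheses (eG : ~~ odd (size G)) (SGa : S (rcons G a))
  (tG : truthful (rcons G a) rho).

Let gG : game F0 (rcons G a) := strat_games str SGa.

(** Serves for false defences and for false formulas asserted as attacks. For a universal formula
    these obtain O's attack in [S] from different sources, hence the separate last hypothesis. *)
Lemma attack_response p A : a.1.2 = Fm p A -> ~~ sat rho A ->
  (forall e, ~ asserts_universal a -> legal F0 (rcons G a) e ->
    S (rcons (rcons G a) e)) ->
  (asserts_universal a ->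
    exists e t, universal_attack e t /\ S (rcons (rcons G a) e)) ->
  exists e, on_course (rcons (rcons G a) e).
Proof.
move=> aA nA Smove Suniv.
have asA := asserts_last G aA.
have univ : asserts_universal a -> exists B, A = All B.
  by move=> [q [B]]; rewrite aA => -[_ ->]; exists B.
have move s : ~ asserts_universal a -> is_attack p A s -> refuted rho A s ->
    (forall q B, s = Fm q B -> sat rho B) ->
    exists e, on_course (rcons (rcons G a) e).
  move=> nu at_ rf tr.
  have le : legal F0 (rcons G a) ((Att, s), Some (size G)).
    by apply: legal_O => //; apply: AnswerAttack at_; apply: asA.
  exists ((Att, s), Some (size G)); split; first exact: Smove.
  exists rho; apply: truthful_O => // s' q B [<-].
  by rewrite aA => -[_ <-].
case: A aA nA asA univ move => [r b|B C|B C|B C|B|B] aA nA asA univ move.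
(* A false atom is impossible here: it would repeat an assertion of O, and those are true. *)
- have en0 := game_atomic gG eG asA.
  have [|q [B [a1 [j [q' [_ jn a2]]]]]] := en0; first by exists r, b.
  have [_ AB] := asserts_inj a1 asA; rewrite AB in a2.
  rewrite (true_O tG _ a2) // in nA.
  by move: jn; rewrite (negbTE eG); case: odd.
- have nu : ~ asserts_universal a by move=> /univ[].
  move: nA; rewrite /= negb_and => /orP[nB|nC].
    by apply: (move (QAnd1 L)) => //; constructor.
  by apply: (move (QAnd2 L)) => //; constructor.
- have nu : ~ asserts_universal a by move=> /univ[].
  by apply: (move (QOr L)) => //; constructor.
- have nu : ~ asserts_universal a by move=> /univ[].
  move: nA; rewrite /= negb_imply => /andP[sB nC].
  apply: (move (Fm (Arg1 :: p) B)) => //; first by constructor.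
  by move=> q D [_ <-].
- have [|e [t [ue Se]]] := Suniv; first by exists p, B.
  have [|x [fx tx]] := strat_universal_fresh str _ Se ue.
    by rewrite size_rcons.
  move: nA => /= /asboolPn/existsNP[d nd].
  have nap : ~ appears (rcons G a) x by case: fx => n [].
  (* The fresh variable of O's attack is made to denote the counterexample [d]. *)
  exists e; split=> //; exists (update rho x d).
  have gS := strat_games str Se; apply: truthful_O => //.
  + exact: truthful_update.
  + by move=> q C; rewrite ue.
  move=> s q C; rewrite ue aA => -[<-] [_ <-] _ /=; rewrite tx -sat_update.
    exact/negP.
  by move=> fvx; apply: nap; left; exists (size G), p, (All B).
- have nu : ~ asserts_universal a by move=> /univ[].
  by apply: (move (QEx L)) => //; constructor.
Qed.

Lemma defence_response s j p A q B : justified_attack (rcons G a) (size G) s j p A ->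
  is_defence p A s q B -> sat rho B ->
  (forall e, e.1.1 = Def -> legal F0 (rcons G a) e -> S (rcons (rcons G a) e)) ->
  exists e, on_course (rcons (rcons G a) e).
Proof.
move=> ja df sB Smove.
have le : legal F0 (rcons G a) ((Def, Fm q B), Some (size G)).
  by apply: legal_O => //; apply: AnswerDefence ja df.
exists ((Def, Fm q B), Some (size G)); split; first exact: Smove.
by exists rho; apply: truthful_O => // r C [_ <-].
Qed.

(** If [a] is a defence, it is false and O attacks it. If [a] attacks an assertion of O, that
    assertion is true, so O has a true defence, or else [a] attacks an implication by a false
    antecedent, which O attacks in turn. *)
Lemma response : exists e, on_course (rcons (rcons G a) e).
Proof.
have lastE := onth_rcons_last G a.
case aE: a.1.1; last first.
  have [p [A sA]] : exists p A, a.1.2 = Fm p A.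
    case: (posnP (size G)) => [G0|G0].
      move: (game_start gG) lastE; rewrite -{1}G0 => -> [<-].
      by exists [::], F0.
    have /justifiedP[m [k [E an]]] : justified (rcons G a) (size G).
      by apply: (game_justified gG); rewrite G0 size_rcons /=.
    move: E aE; rewrite lastE => -[->] /=; case: an => // q B *.
    by exists q, B.
  apply: (attack_response sA).
  - apply: (false_P tG (n := size G) (p := p) (f := a.2)) => //.
    by rewrite lastE -aE -sA; case: (a) => -[].
  - move=> e nu le; apply: (strat_O_moves str) => //.
    by rewrite /existential_attack; case: (a) sA => -[c s] f /= -> [].
  - move=> [p' [B]]; rewrite sA => -[_ AB]; rewrite AB in sA.
    have asA := asserts_last G sA.
    (* [Var 0] only shows that O can move. Whatever move [S] then contains must be a universal
       attack, since a universal defence admits no other reply. *)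
    have [|e Se] := strategy_extends SGa (e := ((Att, QAll (Var 0)), Some (size G))).
      by apply: legal_O => //; apply: AnswerAttack (AttAll _ _ _); apply: asA.
    exists e; have [_ an] := legal_O_answer gG eG (strat_games str Se).
    case eE: e.1 an => [[] s] an.
      have [q [C [a1]]] := answers_attack an.
      by have [_ ->] := asserts_inj a1 asA => /is_attackE[t st]; exists t;
        rewrite /universal_attack eE st.
    have [q [C [t [j [r [D [_ [E _ _] _]]]]]]] := answers_defence an.
    by move: E aE; rewrite lastE => -[->].
have G0 : 0 < size G.
  case: (posnP (size G)) => // G0; move: (game_start gG) lastE aE.
  by rewrite -{1}G0 => -> [<-].
have /justifiedP[m [k [E an]]] : justified (rcons G a) (size G).
  by apply: (game_justified gG); rewrite G0 size_rcons /=.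
have ok : odd k.
  have [||k' [ok' [m' E']]] := game_P_enabler gG (n := size G) => //.
    rewrite size_rcons leqnn andbT ltnNge; apply/negP => le1.
    by move: eG G0 le1; case: (size G) => [|[|]].
  by move: E E' => -> [_ ->].
move: (E); rewrite lastE => -[aE2].
case: m {E} aE2 an aE => [[] s] aE2 an aE; last by rewrite aE2 in aE.
have [p [A [asA at_]]] := answers_attack an.
have ja : justified_attack (rcons G a) (size G) s k p A.
  by split=> //; rewrite lastE aE2.
have sA := true_O tG ok asA.
have dresp q B : s <> QEx L -> is_defence p A s q B -> sat rho B ->
    exists e, on_course (rcons (rcons G a) e).
  move=> nQ df sB; apply: (defence_response ja df sB) => e eD le.
  case: (EM (asserts_universal a)) => [ua|nua].
    by have [+ _] := strat_unskipped str eG SGa aE ua; apply.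
  by apply: (strat_O_moves str) => //; rewrite /existential_attack aE2 => -[].
case: at_ dresp ja sA aE2 => {p A s asA an}
  [p A B|p A B|p A B|p A B|p A t|p A] dresp ja sA aE2.
- have sa : a.1.2 = Fm (Arg1 :: p) A by rewrite aE2.
  move: sA => /=; rewrite implybE; case sA: (sat rho A) => /= sB.
    by apply: (dresp (Arg2 :: p) B) => //; constructor.
  apply: (attack_response sa); rewrite ?sA //.
    move=> e nu le; apply: (strat_O_moves str) => //.
    by rewrite /existential_attack aE2.
  by move=> ua; have [_] := strat_unskipped str eG SGa aE ua.
- by move: sA => /= /andP[sA _]; apply: (dresp (Arg1 :: p) A) => //; constructor.
- by move: sA => /= /andP[_ sB]; apply: (dresp (Arg2 :: p) B) => //; constructor.
- move: sA => /= /orP[sA|sB].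
    by apply: (dresp (Arg1 :: p) A) => //; constructor.
  by apply: (dresp (Arg2 :: p) B) => //; constructor.
- apply: (dresp (Matrix :: p) (inst A t)) => //; first by constructor.
  by move: sA => /= /asboolP sA; rewrite sat_inst.
(* Again [Var 0] only shows that O can move; the defence contained in [S] turns out to use a fresh
   variable, which receives the witness [d] as its value. *)
have [|e Se] := strategy_extends SGa
    (e := ((Def, Fm (Matrix :: p) (inst A (Var 0))), Some (size G))).
  by apply: legal_O => //; apply: AnswerDefence ja _; constructor.
exists e; split=> //.
have [e2 an] := legal_O_answer gG eG (strat_games str Se).
case eE: e.1 an => [[] r] an.
  have [q [B [a1 _]]] := answers_attack an.
  by have := asserts_lastE a1; rewrite aE2.
have [q [B [s [j [p' [A' [rE ja' df]]]]]]] := answers_defence an.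
have [sE _ pE AE] := justified_attack_inj ja' ja; subst s p' A' r.
have [t [qE BE]] : exists t, q = Matrix :: p /\ B = inst A t.
  by inversion df; exists t.
have ed : existential_defence (rcons G a) e t.
  exists (size G), k, p, A; split=> //; rewrite -qE -BE -eE -e2.
  by case: (e).
have [|x [fx [m [k' [p' [A' [ja2 eE2]]]]]]] := strat_existential_fresh str _ Se ed.
  by rewrite size_rcons.
have [mE] : Some m = Some (size G) by rewrite -e2 eE2.
subst m.
have [_ _ pE [AE]] := justified_attack_inj ja2 ja; subst p' A'.
have nap : ~ appears (rcons G a) x by case: fx => n [].
move: sA => /= /asboolP[d sd].
exists (update rho x d); apply: truthful_O => //.
- exact: (strat_games str Se).
- exact: truthful_update.
- move=> q' C; rewrite eE2 => -[_ <-]; rewrite -sat_update //.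
  move=> fvx; apply: nap; left; exists k, p, (Ex A); split=> //.
  by case: ja.
- by move=> s q' C _; rewrite aE2.
Qed.

End Response.

Lemma on_course_exchange G : odd (size G) -> on_course G ->
  exists ee : entry L * entry L, on_course (rcons (rcons G ee.1) ee.2).
Proof.
case/lastP: G => // H a; rewrite size_rcons /= => eH [SG [rho tG]].
have [e [Se [rho' tr]]] := response eH SG tG.
have [e' Se'] : exists e', S (rcons (rcons (rcons H a) e) e').
  by apply: strategy_P_move; rewrite ?size_rcons //= negbK.
exists (e, e'); split=> //; exists rho'; apply: truthful_P => //.
- exact: (strat_games str Se).
- by rewrite !size_rcons /= negbK.
- exact: (strat_games str Se').
Qed.

Lemma strategy_start : S [:: ((Def, Fm [::] F0), None)].
Proof.
have [G SG] := strat_nonempty str; have gG := strat_games str SG.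
case: G SG gG => [|a G] SG gG; first by have := game_size gG.
have := game_start gG => -[<-].
by apply: (strat_prefix str (H := G)).
Qed.

(** Exchanges repeated by dependent choice build an infinite branch of [S], which a winning strategy
    excludes. *)
Lemma on_course_diverges : on_course [:: ((Def, Fm [::] F0), None)] -> False.
Proof.
set a0 := (_, None) => oc0.
pose T := {G | odd (size G) /\ on_course G}.
have step (G : T) : {G' : T | exists e e', sval G' = rcons (rcons (sval G) e) e'}.
  case: G => G [oG oc]; apply: cid.
  have [[e e'] oc'] := on_course_exchange oG oc.
  have oG' : odd (size (rcons (rcons G e) e')) by rewrite !size_rcons /= negbK.
  by exists (exist _ (rcons (rcons G e) e') (conj oG' oc')), e, e'.
have [g [g0 gS]] := dependent_choice step (exist _ [:: a0] (conj isT oc0)).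
pose h n := sval (g n).
have hS n : exists e e', h n.+1 = rcons (rcons (h n) e) e' by apply: gS.
have sz n : size (h n) = n.*2.+1.
  elim: n => [|n IH]; first by rewrite /h g0.
  by have [e [e' ->]] := hS n; rewrite !size_rcons IH.
have ext m n : m <= n -> extends (h m) (h n).
  move=> /subnK <-; elim: (n - m) => [//|k IH]; apply: (extends_trans IH).
  by rewrite addSn; have [e [e' ->]] := hS (k + m); apply: extends_trans;
    apply: extends_rcons.
(* Stage [k] has [k.*2.+1] entries, so its entry [k] exists, and later stages keep it. *)
pose b k := nth a0 (h k) k.
apply: (win.2 b) => n.
suff -> : mkseq b n.+1 = take n.+1 (h n).
  apply: (strat_prefix str (H := drop n.+1 (h n))).
    by move=> /(congr1 size); rewrite size_take sz; case: ifP.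
  by rewrite cat_take_drop; case: (svalP (g n)) => _ [].
have szt : size (take n.+1 (h n)) = n.+1.
  by rewrite size_takel // sz ltnS -addnn leq_addr.
apply: (@eq_from_nth _ a0); rewrite size_mkseq ?szt // => k ltk.
rewrite nth_mkseq // nth_take // /b; have ltk' : k < size (h k).
  by rewrite sz ltnS -addnn leq_addr.
apply/esym/onth_nth; apply: (ext k n) => //.
by rewrite onthE (nth_map a0).
Qed.

End Falsification.

Lemma winning_sat en F S : strategy en F S -> winning F S ->
  forall (I : interp L) (rho : nat -> dom I), sat rho F.
Proof.
move=> str win I rho; apply: contrapT => /negP nF.
apply: (on_course_diverges str win (I := I)); split; first exact: (strategy_start str).
exists rho; split.
- by move=> [|k] p A //= _ [c [f]]; rewrite onth_default.
- by move=> [|m] s k p A //= _ []; rewrite onth_default.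
- by move=> [|n] p A f _; [case=> _ <- _|rewrite onth_default].
Qed.

End Soundness.

(** * Herbrand models *)

Section Herbrand.
Variable L : language.
Implicit Types (t : term L) (A B : form L) (f : fun_symbol L).

Fixpoint tfun f t : Prop :=
  match t with
  | Var _ => False
  | App g a => g = f \/ exists i, tfun f (a i)
  end.

Fixpoint ffun f A : Prop :=
  match A with
  | Atom p a => exists i, tfun f (a i)
  | And B C | Or B C | Imp B C => ffun f B \/ ffun f C
  | All B | Ex B => ffun f B
  end.

(* L may be uncountable, but only the symbols of F matter for F. *)
Definition enumerable (T : Type) (P : T -> Prop) :=
  exists eps : nat -> option T, forall x, P x -> exists i, eps i = Some x.

Lemma enumerable_bigcup (T : Type) (J : countType) (P : J -> T -> Prop) :
  (forall j, enumerable (P j)) -> enumerable (fun x => exists j, P j x).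
Proof.
move=> /choice[eps epsP].
exists (fun n => obind (fun ji : J * nat => eps ji.1 ji.2) (unpickle n)).
by move=> x [j /epsP[i Ei]]; exists (pickle (j, i)); rewrite pickleK.
Qed.

Lemma enumerableU (T : Type) (P Q : T -> Prop) :
  enumerable P -> enumerable Q -> enumerable (fun x => P x \/ Q x).
Proof.
move=> eP eQ; have [|eps epsP] := @enumerable_bigcup T bool (fun b => if b then P else Q).
  by case.
by exists eps => x [Px|Qx]; apply: epsP; [exists true|exists false].
Qed.

Lemma tfun_enumerable t : enumerable (fun f => tfun f t).
Proof.
elim: t => /= [_|g a IH]; first by exists (fun=> None).
apply: enumerableU; last exact: (@enumerable_bigcup _ _ (fun i f => tfun f (a i))).
by exists (fun=> Some g) => f ->; exists 0.
Qed.

Lemma ffun_enumerable A : enumerable (fun f => ffun f A).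
Proof.
elim: A => //= [p a|A ? B ?|A ? B ?|A ? B ?]; try exact: enumerableU.
apply: (@enumerable_bigcup _ _ (fun i f => tfun f (a i))) => i.
exact: tfun_enumerable.
Qed.

Variable eps : nat -> option (fun_symbol L).

(* Codes of the terms built from the function symbols enumerated by eps; a node
   whose label enumerates nothing, or a missing argument, decodes to [Var 0]. *)
Definition code : Type := GenTree.tree nat.

Fixpoint decode (c : code) : term L :=
  match c with
  | GenTree.Leaf x => Var x
  | GenTree.Node i l =>
      if eps i is Some f
      then App (fun j : 'I_(fun_arity f) => nth (Var 0) (map decode l) j)
      else Var 0
  end.

(** A label of [f] picked by choice; a symbol outside the enumeration gets the dummy label 0. *)
Definition rank f : nat :=
  if pselect (exists i, eps i = Some f) is left ex then sval (cid ex) else 0.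

Lemma rankK f : (exists i, eps i = Some f) -> eps (rank f) = Some f.
Proof. by rewrite /rank; case: pselect => // ex _; apply: (svalP (cid ex)). Qed.

(* The domain consists of codes, not of terms, so that it is closed under the
   symbols of F only and every element is named by some [decode c]. *)
Definition herbrand (Q : form L -> Prop) : interp L := {|
  dom := code;
  dom_nonempty := inhabits (GenTree.Leaf 0);
  fun_interp f a := GenTree.Node (rank f) [seq a i | i <- enum 'I_(fun_arity f)];
  rel_interp p a := `[< Q (Atom (fun i => decode (a i))) >] |}.

Notation decode_env rho := (fun x : nat => decode (rho x)).

(** On enumerated symbols, decoding undoes the construction of nodes, so evaluation in the model is
    substitution at the level of terms. *)
Lemma decode_teval Q (rho : nat -> code) t :
  (forall f, tfun f t -> exists i, eps i = Some f) ->
  decode (teval (I := herbrand Q) rho t) = tsubst (decode_env rho) t.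
Proof.
elim: t => //= f a IH ov; rewrite rankK; last by apply: ov; left.
congr App; apply: funext => j; rewrite -IH; last by move=> g ?; apply: ov; right; exists j.
rewrite -map_comp (nth_map j) ?size_enum_ord //=.
by rewrite nth_ord_enum.
Qed.

(* The formulas that P can afford to assert when O has asserted the atoms in Q:
   a chain of forced existential defences from A can be made to end in a
   compound formula or in an atom of Q. *)
Inductive ready (Q : form L -> Prop) : form L -> Prop :=
| ReadyAtom A of atomic A & Q A : ready Q A
| ReadyEx A t of ready Q (inst A t) : ready Q (Ex A)
| ReadyOther A of ~ atomic A & (forall B, A <> Ex B) : ready Q A.

Lemma ready_mono (Q R : form L -> Prop) A :
  (forall B, Q B -> R B) -> ready Q A -> ready R A.
Proof.
by move=> QR; elim=> [B aB /QR|B t _|B nB neB];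
  [apply: ReadyAtom|apply: ReadyEx|apply: ReadyOther].
Qed.

Lemma sat_atom Q rho p a :
  (forall f, ffun f (Atom a) -> exists i, eps i = Some f) ->
  sat (I := herbrand Q) rho (@Atom L p a) = `[< Q (fsubst (decode_env rho) (Atom a)) >].
Proof.
move=> ov /=; congr (`[< Q (Atom _) >]); apply: funext => i.
by apply: decode_teval => f fi; apply: ov; exists i.
Qed.

(** Why waiting costs P nothing: a true formula is never suicidal once O has asserted the atoms in
    [Q]. A witness in the model is a code, and decoding it gives the term with which P defends. *)
Lemma sat_ready Q rho A : (forall f, ffun f A -> exists i, eps i = Some f) ->
  sat (I := herbrand Q) rho A -> ready Q (fsubst (decode_env rho) A).
Proof.
elim: A rho => [p a|A _ B _|A _ B _|A _ B _|A _|A IH] rho ov; last first.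
- move=> /= /asboolP[d /(IH _ ov)]; rewrite scons_comp -inst_fsubst.
  exact: ReadyEx.
- by move=> _; apply: ReadyOther => [[p [a]]|B].
- by move=> _; apply: ReadyOther => [[p [a]]|C].
- by move=> _; apply: ReadyOther => [[p [a]]|C].
- by move=> _; apply: ReadyOther => [[p [a]]|C].
rewrite sat_atom // => /asboolP Qa; apply: ReadyAtom => //.
by exists p; eexists.
Qed.

End Herbrand.

(** * Winning positions and strategies *)

Section StrategyTree.
Variables (L : language) (en : nat -> nat) (F : form L).
Hypothesis en_surj : forall x, exists n, en n = x.
Implicit Types (G H : seq (entry L)) (e a : entry L) (A B : form L).

Definition canonical G e : Prop :=
  (forall t, universal_attack e t ->
    exists x, first_fresh en G x /\ t = Var x) /\
  (forall t, existential_defence G e t ->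
    exists x, first_fresh en G x /\ existential_defence G e (Var x)).

Definition reply G e : Prop := legal F G e /\ canonical G e.

(* The second part is what [strat_P_existential] demands of P. *)
Definition prompt G e : Prop := legal F G e /\
  forall H a, G = rcons H a -> existential_attack a -> e.2 = Some (size H).

(** O is to move in [G]. Being inductive, the predicate admits only plays that come to an end, which
    happens when O has no reply. *)
Inductive P_wins G : Prop := PWins (r : entry L -> entry L)
  of (forall e, reply G e -> prompt (rcons G e) (r e))
   & (forall e, reply G e -> P_wins (rcons (rcons G e) (r e))).

(** As [P_wins], but with a single move function on histories in place of one chosen afresh at each
    position. *)
Inductive wins_by (sigma : seq (entry L) -> entry L) G : Prop := WinsBy
  of (forall e, reply G e -> prompt (rcons G e) (sigma (rcons G e)))
   & (forall e, reply G e -> wins_by sigma (rcons (rcons G e) (sigma (rcons G e)))).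

Lemma wins_by_eq sigma tau G : (forall H, sigma (G ++ H) = tau (G ++ H)) ->
  wins_by sigma G -> wins_by tau G.
Proof.
move=> + w; elim: w => {}G pr _ IH eq_st.
have eq1 e : sigma (rcons G e) = tau (rcons G e) by rewrite -cats1.
split=> e re; rewrite -eq1; first exact: pr.
by apply: IH => // H; rewrite -!cats1 -!catA.
Qed.

(* The moves r e continue into histories that differ at index size G, so the
   strategies chosen for the different replies e can be glued together. *)
Lemma P_wins_by G : P_wins G -> exists sigma, wins_by sigma G.
Proof.
elim=> {}G r pr _ IH.
pose e0 : entry L := ((Att, QOr L), None).
have ex e : exists s, reply G e -> wins_by s (rcons (rcons G e) (r e)).
  case: (EM (reply G e)) => [/IH[s]|nr]; first by exists s.
  by exists (fun=> e0).
have [sg sgP] := choice ex.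
pose tau K := if size K == (size G).+1 then r (nth e0 K (size G))
  else sg (nth e0 K (size G)) K.
have tauG e : tau (rcons G e) = r e by rewrite /tau size_rcons eqxx nth_rcons ltnn eqxx.
exists tau; split=> e re; rewrite tauG; first exact: pr.
apply: (wins_by_eq _ (sgP e re)) => H.
rewrite /tau size_cat !size_rcons gtn_eqF ?leq_addr //.
by rewrite nth_cat !size_rcons ltnS leqnSn !nth_rcons size_rcons ltnSn ltnn eqxx.
Qed.

(** A term chosen by O may be replaced by the first fresh variable without loss of legality. So a
    position without canonical replies has no legal ones either. *)
Lemma canonical_reply G e : odd (size G) -> game F G -> legal F G e ->
  exists e', reply G e'.
Proof.
case/lastP: G => // G a; rewrite size_rcons /= => eG gG le.
have [x fx] := first_fresh_exists (rcons G a) en_surj.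
have [e2 an] := legal_O_answer gG eG le.
case: (EM (exists t, universal_attack e t)) => [[t ue]|nu].
  have [p [A [asA at_]]] : exists p A, asserts (rcons G a) (size G) p A /\
      is_attack p A (QAll t).
    by apply: answers_attack; rewrite -ue.
  exists ((Att, QAll (Var x)), Some (size G)); split.
    apply: legal_O => //; apply: AnswerAttack asA _.
    by inversion at_; constructor.
  split=> [_ [<-]|s [m [k [q [B [_ []]]]]] //].
  by exists x.
case: (EM (exists t, existential_defence (rcons G a) e t)) => [[t ed]|ne]; last first.
  exists e; split=> //; split=> t; last by move=> ed; case: ne; exists t.
  by move=> ue; case: nu; exists t.
have [m [k [p [A [ja eE]]]]] := ed.
have [mE] : Some m = Some (size G) by rewrite -e2 eE.
subst m; exists ((Def, Fm (Matrix :: p) (inst A (Var x))), Some (size G)); split.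
  by apply: legal_O => //; apply: AnswerDefence ja _; constructor.
split=> // s _; exists x; split=> //; by exists (size G), k, p, A.
Qed.

(** * The tree of games generated by a move function *)

Inductive course (sigma : seq (entry L) -> entry L) : seq (entry L) -> Prop :=
| CourseStart : course sigma [:: ((Def, Fm [::] F), None)]
| CourseO G e of course sigma G & odd (size G) & reply G e :
    course sigma (rcons G e)
| CourseP G of course sigma G & ~~ odd (size G) :
    course sigma (rcons G (sigma G)).

Lemma course_rcons sigma G e : course sigma (rcons G e) ->
  G = [::] /\ e = ((Def, Fm [::] F), None) \/
  course sigma G /\ if odd (size G) then reply G e else e = sigma G.
Proof.
move E : (rcons G e) => K cK; case: cK E.
- by case: G => [|a [|b G]] // [->]; left.
- by move=> H d cH oH rd /rcons_inj[-> ->]; right; rewrite oH.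
- by move=> H cH eH /rcons_inj[-> ->]; right; rewrite (negbTE eH).
Qed.

Section Course.
Variable sigma : seq (entry L) -> entry L.
Hypotheses (nF : ~ atomic F)
  (win : wins_by sigma [:: ((Def, Fm [::] F), None)]).

Lemma course_wins G : course sigma G ->
  if odd (size G) then wins_by sigma G else prompt G (sigma G) /\
    wins_by sigma (rcons G (sigma G)).
Proof.
elim=> {G} [|G e cG IH oG re|G cG IH eG] //=.
  by rewrite size_rcons /= oG /=; rewrite oG in IH; case: IH => pr wi; split; auto.
by rewrite size_rcons /= eG; rewrite (negbTE eG) in IH; case: IH.
Qed.

Lemma course_game G : course sigma G -> game F G.
Proof.
case=> [|{}G e cG oG [] //|{}G cG eG]; first exact: game_single.
by have := course_wins cG; rewrite (negbTE eG) => -[[]].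
Qed.

Lemma course_O G e : odd (size G) -> course sigma (rcons G e) ->
  course sigma G /\ reply G e.
Proof. by move=> oG /course_rcons[[GE _]|]; [rewrite GE in oG|rewrite oG]. Qed.

Lemma universal_attack_target G a e t : game F (rcons G a) -> ~~ odd (size G) ->
  legal F (rcons G a) e -> universal_attack e t -> asserts_universal a.
Proof.
move=> gG eG le ue; have [_] := legal_O_answer gG eG le.
rewrite ue => /answers_attack[p [A [/asserts_lastE aA at_]]].
by have := is_attackE at_; case: A aA {at_} => // [B C _ []//|B aA _]; exists p, B.
Qed.

Lemma existential_defence_enabler G a e t : game F (rcons G a) ->
  ~~ odd (size G) -> legal F (rcons G a) e ->
  existential_defence (rcons G a) e t ->
  exists k p A, [/\ justified_attack (rcons G a) (size G) (QEx L) k p (Ex A),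
    e = ((Def, Fm (Matrix :: p) (inst A t)), Some (size G)) & existential_attack a].
Proof.
move=> gG eG le [m [k [p [A [ja eE]]]]]; have [e2 _] := legal_O_answer gG eG le.
have [mE] : Some m = Some (size G) by rewrite -e2 eE.
subst m; exists k, p, A; split=> //; case: ja.
by rewrite onth_rcons_last => -[->].
Qed.

(** The exclusions leave the O-moves that choose no term, for which [canonical] is void. *)
Lemma course_O_move G a e : ~~ odd (size G) -> course sigma (rcons G a) ->
  legal F (rcons G a) e -> ~ (asserts_universal a /\ e.1.1 = Att) ->
  ~ existential_attack a -> course sigma (rcons (rcons G a) e).
Proof.
move=> eG cG le nu ne; have gG := course_game cG.
apply: CourseO => //; first by rewrite size_rcons.
split=> //; split=> t.
  move=> ue; case: nu; split; first exact: (universal_attack_target gG eG le ue).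
  by rewrite ue.
by move/(existential_defence_enabler gG eG le) => [k [p [A [_ _ ea]]]].
Qed.

(** P's move is unique as a value of [sigma]. O's choices are unique because the first fresh
    variable is, and because O's enabler is forced. *)
Lemma course_strategy : strategy en F (course sigma).
Proof.
have oddP G : odd (size G) -> exists H a, G = rcons H a /\ ~~ odd (size H).
  by case/lastP: G => // H a; rewrite size_rcons; exists H, a.
split.
- exact: course_game.
- by eexists; apply: CourseStart.
- move=> G H nG; elim/last_ind: H => [|H e IH]; first by rewrite cats0.
  rewrite -rcons_cat => /course_rcons[[GH _]|[/IH]//].
  by case: G nG GH {IH}.
- move=> G a e eG cG nu ne le; apply: course_O_move => //.
  by case.
- move=> G a eG cG aA ua; have gG := course_game cG.
  have ne : ~ existential_attack a.
    by case: ua => p [A]; rewrite /existential_attack; case: (a) => -[c s] f /= -> [].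
  split=> [e eD le|]; first by apply: course_O_move => //; rewrite eD => -[].
  have [x fx] := first_fresh_exists (rcons G a) en_surj.
  have [p [A Ea]] := ua.
  exists ((Att, QAll (Var x)), Some (size G)), (Var x); split=> //.
  apply: CourseO => //; first by rewrite size_rcons.
  split; first by apply: legal_O => //; apply: AnswerAttack (asserts_last G Ea) _; constructor.
  split=> [_ [<-]|s [m [k [q [B [_ []]]]]] //].
  by exists x.
- move=> G e e' eG cG cG'.
  have := course_rcons cG'; have := course_rcons cG; rewrite (negbTE eG).
  have c0 : G = [::] -> ~ course sigma G by move=> -> /course_game/game_size.
  by move=> [[G0 ->]|[c ->]] [[G0' ->]|[c' ->]] //; [case: (c0 G0)|case: (c0 G0')].
- move=> G e e' t t' oG /(course_O oG)[cG [le [ce _]]] /(course_O oG)[_ [le' [ce' _]]].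
  move=> ue ue'; have [H [a [GE eH]]] := oddP G oG; subst G.
  have gG := course_game cG.
  have [e2 _] := legal_O_answer gG eH le; have [e2' _] := legal_O_answer gG eH le'.
  have [x [fx tx]] := ce t ue; have [x' [fx' tx']] := ce' t' ue'.
  have xx := first_fresh_inj fx fx'; subst t t' x'.
  case: e e' ue ue' e2 e2' {le le' ce ce'} => [m k] [m' k'].
  by rewrite /universal_attack /= => -> -> -> ->.
- by move=> G e t oG /(course_O oG)[_ [_ [ce _]]]; apply: ce.
- move=> G e e' t t' oG /(course_O oG)[cG [le [_ ce]]] /(course_O oG)[_ [le' [_ ce']]].
  move=> ed ed'; have [H [a [GE eH]]] := oddP G oG; subst G.
  have gG := course_game cG.
  have [x [fx edx]] := ce t ed; have [x' [fx' edx']] := ce' t' ed'.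
  have xx := first_fresh_inj fx fx'; subst x'.
  have [k [p [A [ja -> _]]]] := existential_defence_enabler gG eH le edx.
  have [k' [p' [A' [ja' -> _]]]] := existential_defence_enabler gG eH le' edx'.
  by have [_ _ -> [->]] := justified_attack_inj ja ja'.
- by move=> G e t oG /(course_O oG)[_ [_ [_ ce]]]; apply: ce.
- move=> G a oG cG ea; have := course_wins cG; rewrite size_rcons /= oG /=.
  set e := sigma _; move=> [[le /(_ G a erefl ea) e2] _].
  have gG := course_game cG.
  have [|k [e2' ok an]] := legal_P_answer gG _ le; first by rewrite size_rcons /= oG.
  exists e; move: e2'; rewrite e2 => -[kE]; subst k.
  (* An existential attack asserts nothing, so a move enabled by it can only be a defence. *)
  case mE: e.1 an => [[] s] an.
    have [p [A [/asserts_lastE]]] := answers_attack an.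
    by rewrite ea.
  have [q [B [s' [j [p [A [sE ja df]]]]]]] := answers_defence an.
  have [E a1 a2] := ja; move: E; rewrite onth_rcons_last => -[aE].
  have s'E : s' = QEx L by move: ea; rewrite aE => -[].
  have [C [t [AE [qE BE]]]] : exists C t, A = Ex C /\ q = Matrix :: p /\ B = inst C t.
    by rewrite s'E in df; inversion df; eexists; eexists.
  subst s' A q B; exists t; split; last split.
  - by apply: CourseP => //; rewrite size_rcons /= oG.
  - by exists (size G), j, p, C; split=> //; move: e2 mE; rewrite sE; case: (e) => ? ? /= -> ->.
  - by [].
Qed.

Lemma course_winning : winning F (course sigma).
Proof.
split=> [G cG max|b cb].
  have oG : odd (size G).
    by apply: contrapT => /negP eG; apply: (max (sigma G)); apply: CourseP.
  have gG := course_game cG.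
  split=> // e le; have [e' re] := canonical_reply oG gG le.
  by apply: (max e'); apply: CourseO.
have c0 : course sigma (rcons [::] (b 0)) by apply: (cb 0).
have [[_ b0]|[/course_game/game_size]] := course_rcons c0; last by [].
have start : wins_by sigma (mkseq b 1) by rewrite /mkseq /= b0.
(* Each exchange along [b] descends to an immediate subtree of the well-founded [wins_by]. In
   [mkseq b n.+1] O is to move, [b n.+1] is O's reply and [b n.+2] is P's. *)
have stop G : wins_by sigma G -> forall n, G = mkseq b n.+1 -> odd n.+1 -> False.
  elim=> {}G _ _ IH n GE on.
  have mkS m : mkseq b m.+1 = rcons (mkseq b m) (b m).
    by rewrite /mkseq -addn1 iotaD map_cat cats1.
  have [_ re] : course sigma G /\ reply G (b n.+1).
    by apply: course_O; rewrite GE ?size_mkseq // -mkS.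
  apply: (IH _ re n.+2); last by rewrite /= negbK.
  have := cb n.+2; rewrite mkS => /course_rcons[[]|[_]].
    by move/(congr1 size); rewrite size_mkseq.
  have nE : odd n = false by apply: negbTE.
  rewrite size_mkseq !oddS nE => bE.
  by rewrite bE [mkseq b n.+2]mkS -GE.
exact: (stop _ start 0).
Qed.

End Course.

Lemma P_wins_valid : ~ atomic F -> P_wins [:: ((Def, Fm [::] F), None)] ->
  dialogically_valid en F.
Proof.
move=> nF /P_wins_by[sigma win]; exists (course sigma); split.
  exact: course_strategy.
exact: course_winning.
Qed.

End StrategyTree.

(** * Completeness *)

Section Completeness.
Variables (L : language) (en : nat -> nat) (F : form L).
Variable eps : nat -> option (fun_symbol L).
Implicit Types (G H : seq (entry L)) (e a : entry L) (A B : form L).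

Notation reply := (reply en F).
Notation prompt := (prompt F).
Notation P_wins := (P_wins en F).
Notation decode := (decode eps).

(** Read at P's turn, whereas [P_wins] is read at O's turn. *)
Definition lost G : Prop := forall e, prompt G e -> ~ P_wins (rcons G e).

(** If every reply of O left P a winning move, choice would collect these moves into the function
    that [P_wins] asks for. *)
Lemma not_P_wins G :
  ~ P_wins G -> exists e, reply G e /\ lost (rcons G e).
Proof.
move=> nw; apply: contrapT => /forallNP nl; apply: nw.
have ex e : exists d, reply G e -> prompt (rcons G e) d /\ P_wins (rcons (rcons G e) d).
  case: (EM (reply G e)) => [re|nr]; last by exists e.
  have [d Hd] : exists d, ~ (prompt (rcons G e) d -> ~ P_wins (rcons (rcons G e) d)).
    by apply/existsNP => lo; apply: (nl e).
  by exists d => _; move/not_implyP: Hd => [pr /contrapT].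
have [r rP] := choice ex.
by exists r => e /rP[].
Qed.

(** No existential attack is pending, so that [prompt] reduces to legality. *)
Definition calm G : Prop := forall H a, G = rcons H a -> ~ existential_attack a.

(** O's choices being variables, they are decodings of leaves, hence named by elements of the
    Herbrand domain. *)
Definition named G : Prop := forall n e, odd n -> onth G n = Some e ->
  (forall t, universal_attack e t -> exists x, t = Var x) /\
  (forall t, existential_defence G e t -> exists x, existential_defence G e (Var x)).

Lemma existential_defence_ext G H e t :
  extends G H -> existential_defence G e t -> existential_defence H e t.
Proof.
move=> GH [m [k [p [A [ja eE]]]]]; exists m, k, p, A; split=> //.
exact: justified_attack_ext ja.
Qed.

Lemma existential_defence_rcons G a e t n : game F (rcons G a) -> n <= size G ->
  onth (rcons G a) n = Some e ->
  existential_defence (rcons G a) e t -> existential_defence G e t.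
Proof.
move=> gG len E [m [k [p [A [ja eE]]]]]; exists m, k, p, A; split=> //.
have pj := game_prejustified gG; apply: justified_attack_rcons ja => //.
by apply: leq_trans len; apply: (pj n e.1); rewrite E {1}eE /= eE.
Qed.

Lemma named_rcons G a : game F (rcons G a) -> named G ->
  (odd (size G) -> canonical en G a) -> named (rcons G a).
Proof.
move=> gG nG ca n e on E.
have len : n <= size G by move: (onth_lt E); rewrite size_rcons ltnS.
have ext := @extends_rcons _ G a.
move: (E); rewrite onth_rcons; case: ifP => [_ E'|_].
  have [nu ne] := nG n e on E'; split=> // t /(existential_defence_rcons gG len E)/ne[x].
  by exists x; apply: existential_defence_ext ext _.
case: eqP => // nE [ae]; subst n e; have [cu ce] := ca on; split=> t.
  by move/cu => [x [_ ->]]; exists x.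
move/(existential_defence_rcons gG len E)/ce => [x [_ ed]].
by exists x; apply: existential_defence_ext ext _.
Qed.

Record state G : Prop := State {
  state_game : game F G;
  state_even : ~~ odd (size G);
  state_lost : lost G;
  state_named : named G }.

Lemma state_exchange G e : state G -> prompt G e ->
  exists e', state (rcons (rcons G e) e').
Proof.
move=> [gG eG lG nG] pe; have [e' [[le ce] lo]] := not_P_wins (lG e pe).
have gGe : game F (rcons G e) by case: pe.
exists e'; split=> //; first by rewrite !size_rcons /= negbK.
apply: named_rcons => //; apply: named_rcons => //.
by rewrite (negbTE eG).
Qed.

(** O must answer the preceding move, so each P-move is dealt with at once. Therefore only P has to
    be made to play fairly. *)
Lemma reply_at G i e : game F G -> ~~ odd i -> i.+1 < size G ->
  onth G i = Some e ->
  (exists s p B, e.1.2 = Fm p B /\ justified_attack G i.+1 s i p B) \/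
  (exists q C s k p A, [/\ onth G i.+1 = Some ((Def, Fm q C), Some i),
    e = ((Att, s), Some k), justified_attack G i s k p A & is_defence p A s q C]).
Proof.
move=> gG ei lt E.
have /justifiedP[m [k [E' an]]] : justified G i.+1 by apply: (game_justified gG).
have [|m' E2] := game_O_enabler gG lt; first by rewrite /= ei.
have ki : i = k by have := E'; rewrite E2 => -[_].
subst k.
case: m E' an => [[] s] E' an.
  have [p [A [asA at_]]] := answers_attack an.
  left; exists s, p, A; split; last by split.
  by case: asA => c [f]; rewrite E => -[->].
have [q [B [s' [j [p [A [sE ja df]]]]]]] := answers_defence an.
subst s; right; exists q, B, s', j, p, A; split=> //.
by case: ja; rewrite E => -[->].
Qed.

(** P answers a pending existential attack with the terms that readiness provides. The chain cannot
    end in an atom: O would have no reply to it, although P is lost. So it ends with an attack on a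
    formula that is not existential. *)
Lemma settle Q B : ready Q B -> forall G s k p, state G ->
  (forall A, Q A -> opponent_asserts G A) ->
  justified_attack G (size G).-1 s k p B ->
  exists G', [/\ extends G G', state G' & calm G'].
Proof.
elim=> {B} [B [r [b ->]] QB|B t rd IH|B nB neB] G s k p sG QG ja; have [E a1 a2] := ja.
- by have := is_attackE a2.
- have sE := is_attackE a2; rewrite /= in sE; subst s.
  have gG := state_game sG; have eG := state_even sG; have G0 := game_size gG.
  pose e : entry L := ((Def, Fm (Matrix :: p) (inst B t)), Some (size G).-1).
  have pe : prompt G e.
    split; last by move=> H a GE _; rewrite /= GE size_rcons.
    apply/(legalP _ gG); split=> [|_ q C [_ <-] aB|_ _ m _ Em].
    + exists (size G).-1; rewrite (negbTE eG); split=> //.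
        by move: eG G0; case: (size G) => //= n; rewrite negbK.
      exact: AnswerDefence ja (DefEx _ _ _).
    + by apply: QG; case: rd aB => // C' t' _ [? []].
    (* A move enabled by the last entry of [G] cannot already occur in [G]. *)
    + have := game_prejustified gG Em; have := onth_lt Em.
      by move=> lt1 lt2; have := leq_ltn_trans lt2 lt1; rewrite prednK // ltnn.
  have [e' sK] := state_exchange sG pe.
  have gK := state_game sK.
  have ext : extends G (rcons (rcons G e) e').
    by apply: extends_trans; apply: extends_rcons.
  have [||[s' [p' [B' [[_ BE] ja']]]]|[q [C [s' [k' [p' [A []]]]]]]] :=
      reply_at (e := e) gK eG; rewrite ?size_rcons ?onth_rcons_last //.
    by rewrite onth_rcons size_rcons ltnSn onth_rcons_last.
  rewrite -BE in ja'.
  have [||G' [GG' sG' cG']] := IH _ s' (size G) p' sK _ _.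
  + by move=> A /QG; apply: opponent_asserts_ext.
  + by rewrite !size_rcons.
  by exists G'; split=> //; apply: extends_trans GG'.
exists G; split=> // H a GE ea; move: E; rewrite GE size_rcons onth_rcons_last => -[aE].
have sE : s = QEx L by move: ea; rewrite aE => -[].
have := is_attackE a2; rewrite sE; case: B nB neB {ja a1 a2} => //.
- by move=> ? ? ? ? [].
- by move=> ? ? ? [].
by move=> B _ /(_ B).
Qed.

(** Either O defends and nothing is pending, or O attacks the formula just asserted and [settle]
    restores calm. *)
Lemma settled_move G e : state G -> calm G -> legal F G e ->
  (forall p B, e.1.2 = Fm p B -> ready (opponent_asserts G) B) ->
  exists G', [/\ extends (rcons G e) G', state G', calm G' & (size G).+1 < size G'].
Proof.
move=> sG cG le rd; have eG := state_even sG.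
have pe : prompt G e by split=> // H a GE /(cG _ _ GE).
have [e' sK] := state_exchange sG pe; have gK := state_game sK.
have szK : size (rcons (rcons G e) e') = (size G).+2 by rewrite !size_rcons.
have lastE : onth (rcons (rcons G e) e') (size G) = Some e.
  by rewrite onth_rcons size_rcons ltnSn onth_rcons_last.
have ext := @extends_rcons _ (rcons G e) e'.
have [|[s [p [B [eB ja]]]]|[q [C [s [k [p [A [E _ _ _]]]]]]]] := reply_at gK eG _ lastE.
- by rewrite szK.
- have [||G' [GG' sG' cG']] := settle (rd _ _ eB) sK (s := s) (k := size G) (p := p) _ _.
  + by move=> A; apply/opponent_asserts_ext/(extends_trans _ ext)/extends_rcons.
  + by rewrite szK.
  exists G'; split=> //; first exact: extends_trans GG'.
  by case: ja => /GG'/onth_lt.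
exists (rcons (rcons G e) e'); split=> //; last by rewrite szK.
move=> H a /rcons_inj[_ <-] ea.
move: E; rewrite -(size_rcons G e) onth_rcons_last => -[e'E].
by move: ea; rewrite e'E.
Qed.

(* In a task (k, d, b, c), the move at k is attacked if d and answered otherwise,
   b chooses among the two sides of a connective and c codes a term. *)
Definition task : Type := nat * bool * bool * code.

Definition attack_plan (b : bool) (c : code) p A : option (symbol L) :=
  match A with
  | Atom _ _ => None
  | Imp B _ => Some (Fm (Arg1 :: p) B)
  | And _ _ => Some (if b then QAnd1 L else QAnd2 L)
  | Or _ _ => Some (QOr L)
  | All _ => Some (QAll (decode c))
  | Ex _ => Some (QEx L)
  end.

Definition defence_plan (b : bool) (c : code) p A (s : symbol L) : option (symbol L) :=
  match A, s with
  | Imp _ C, _ => Some (Fm (Arg2 :: p) C)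
  | And B _, QAnd1 => Some (Fm (Arg1 :: p) B)
  | And _ C, QAnd2 => Some (Fm (Arg2 :: p) C)
  | Or B C, _ => Some (if b then Fm (Arg1 :: p) B else Fm (Arg2 :: p) C)
  | All B, QAll t => Some (Fm (Matrix :: p) (inst B t))
  | Ex B, _ => Some (Fm (Matrix :: p) (inst B (decode c)))
  | _, _ => None
  end.

Definition plan G (tau : task) : option (entry L) :=
  let: (k, d, b, c) := tau in
  if d then
    if onth G k is Some ((_, Fm p A), _)
    then omap (fun s => ((Att, s), Some k)) (attack_plan b c p A) else None
  else
    if onth G k is Some ((Att, s), Some j) then
      if onth G j is Some ((_, Fm p A), _)
      then omap (fun r => ((Def, r), Some k)) (defence_plan b c p A s) else None
    else None.

Lemma plan_ext G H tau e : extends G H -> plan G tau = Some e -> plan H tau = Some e.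
Proof.
move=> GH; case: tau => [[[k d] b] c]; rewrite /plan; case: d.
  by case E: (onth G k) => [x|//]; rewrite (GH _ _ E).
case E: (onth G k) => [[[[] s] [j|]]|] //; rewrite (GH _ _ E).
by case E': (onth G j) => [x|//]; rewrite (GH _ _ E').
Qed.

Lemma plan_attack G k p A b c s : asserts G k p A -> attack_plan b c p A = Some s ->
  plan G (k, true, b, c) = Some ((Att, s), Some k).
Proof. by move=> [x [f E]] pl; rewrite /plan E pl. Qed.

Lemma plan_defence G m s k p A b c r : justified_attack G m s k p A ->
  defence_plan b c p A s = Some r -> plan G (m, false, b, c) = Some ((Def, r), Some m).
Proof. by move=> [E [x [f E']] _] pl; rewrite /plan E E' pl. Qed.

(** One step of P: the task is carried out if it is legal and affordable, and otherwise skipped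
    until it recurs. The assumptions stand under the existential so that choice yields a total
    function. *)
Lemma advance (Gtau : seq (entry L) * task) : exists G',
  state Gtau.1 /\ calm Gtau.1 ->
  [/\ state G', calm G', extends Gtau.1 G' & forall e, plan Gtau.1 Gtau.2 = Some e ->
    legal F Gtau.1 e ->
    (forall p B, e.1.2 = Fm p B -> ready (opponent_asserts Gtau.1) B) ->
    onth G' (size Gtau.1) = Some e /\ (size Gtau.1).+1 < size G'].
Proof.
case: Gtau => G tau /=.
case: (EM (exists e, [/\ plan G tau = Some e, legal F G e &
    forall p B, e.1.2 = Fm p B -> ready (opponent_asserts G) B])) => [[e [pl le rd]]|ne].
  case: (EM (state G /\ calm G)) => [[sG cG]|ns]; last by exists G.
  have [G' [ext sG' cG' sz]] := settled_move sG cG le rd; exists G' => _.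
  split=> //; first exact: extends_trans (@extends_rcons _ _ _) ext.
  move=> e'; rewrite pl => -[<-] _ _; split=> //.
  by apply: ext; rewrite onth_rcons_last.
by exists G => -[sG cG]; split=> // e pl le rd; case: ne; exists e.
Qed.

(* Every task recurs, at 2 ^ i * 3 ^ N for all N. *)
Definition schedule (n : nat) : task :=
  odflt (0, true, true, GenTree.Leaf 0) (unpickle (logn 2 n)).

Lemma schedule_fair tau N : exists2 n, N <= n & schedule n = tau.
Proof.
exists (2 ^ pickle tau * 3 ^ N).
  apply: leq_trans (leq_pmull _ _); last by rewrite expn_gt0.
  exact/ltnW/ltn_expl.
rewrite /schedule lognM ?expn_gt0 // pfactorK // lognX.
by rewrite (logn_coprime (m := 3)) // muln0 addn0 pickleK.
Qed.

Lemma fair_stages G0 : state G0 -> calm G0 ->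
  exists st : nat -> seq (entry L), [/\ st 0 = G0, forall n, state (st n),
    forall m n, m <= n -> extends (st m) (st n) &
    forall n e, plan (st n) (schedule n) = Some e -> legal F (st n) e ->
      (forall p B, e.1.2 = Fm p B -> ready (opponent_asserts (st n)) B) ->
      onth (st n.+1) (size (st n)) = Some e /\ (size (st n)).+1 < size (st n.+1)].
Proof.
move=> sG0 cG0; have [f fP] := choice advance.
pose st := fix st n := if n is m.+1 then f (st m, schedule m) else G0.
have inv n : state (st n) /\ calm (st n).
  by elim: n => // n /(fP (st n, schedule n))[].
exists st; split=> // [n|m n /subnK <-|n]; first by case: (inv n).
  elim: (n - m) => // k IH; apply: (extends_trans IH).
  by have [] := fP (st (k + m), schedule (k + m)) (inv _).
by have [_ _ _] := fP (st n, schedule n) (inv n).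
Qed.

(** * The limit of a fair play and its Herbrand model *)

Section Limit.
Variable st : nat -> seq (entry L).
Hypotheses (st_state : forall n, state (st n))
  (st_ext : forall m n, m <= n -> extends (st m) (st n))
  (st_fair : forall n e, plan (st n) (schedule n) = Some e -> legal F (st n) e ->
      (forall p B, e.1.2 = Fm p B -> ready (opponent_asserts (st n)) B) ->
      onth (st n.+1) (size (st n)) = Some e /\ (size (st n)).+1 < size (st n.+1)).

Definition limit_asserts A : Prop := exists n, opponent_asserts (st n) A.

Definition limit_attacks A : Prop := exists n m s k p,
  odd m /\ justified_attack (st n) m s k p A.

(** Readiness depends on at most one atom, which O has asserted at some finite stage. *)
Lemma ready_stage A : ready limit_asserts A ->
  exists n, ready (opponent_asserts (st n)) A.
Proof.
elim=> {A} [A aA [n As]|A t _ [n rd]|A nA neA].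
- by exists n; apply: ReadyAtom.
- by exists n; apply: ReadyEx rd.
- by exists 0; apply: ReadyOther.
Qed.

(** When the task recurs after stage [N], either the move was made before, or nothing forbids it and
    it is made then. *)
Lemma played N e tau k : plan (st N) tau = Some e -> e.2 = Some k -> odd k ->
  answers (st N) e.1 k ->
  (forall p B, e.1.2 = Fm p B -> ready (opponent_asserts (st N)) B) ->
  exists n i, [/\ ~~ odd i, i.+1 < size (st n) & onth (st n) i = Some e].
Proof.
move=> pl e2 ok an rd; have [n leN sn] := schedule_fair tau N.
have ext := st_ext leN; have sS := st_state n.
have gS := state_game sS; have eS := state_even sS.
case: (EM (exists2 i, ~~ odd i & onth (st n) i = Some e)) => [[i ei E]|nE].
  (* Stages have even size, so a P-move is never last in one. *)
  exists n, i; split=> //; have := onth_lt E; rewrite leq_eqVlt => /predU1P[iE|//].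
  by rewrite -iE /= ei in eS.
have rd' p B : e.1.2 = Fm p B -> ready (opponent_asserts (st n)) B.
  by move/rd; apply: ready_mono => C; apply: opponent_asserts_ext.
have [||E lt] := st_fair (n := n) (e := e) _ _ rd'.
- by rewrite sn; apply: plan_ext pl.
- apply/(legalP _ gS); split=> [|_ p B eB aB|_ _ i ei E].
  + by exists k; rewrite (negbTE eS); split=> //; apply: answers_ext an.
  + by case: (rd' _ _ eB) aB => // C t _ [? []].
  + by case: nE; exists i.
by exists n.+1, (size (st n)).
Qed.

(** P eventually gives this defence, and O's only way to answer a defence is to attack the formula
    it asserts. *)
Lemma option_attacked N m s k p A b c q B :
  odd m -> justified_attack (st N) m s k p A -> is_defence p A s q B ->
  defence_plan b c p A s = Some (Fm q B) -> ready limit_asserts B ->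
  limit_attacks B.
Proof.
move=> om ja df pl /ready_stage[n0 rd].
have ext := st_ext (leq_maxl N n0); have ja' := justified_attack_ext ext ja.
have [|n [i [ei lt E]]] := played (plan_defence ja' pl) erefl om (AnswerDefence ja' df).
  move=> _ _ [_ <-]; apply: ready_mono rd => C; apply: opponent_asserts_ext.
  exact: st_ext (leq_maxr N n0).
have [[s' [p' [C [/= [_ <-] jr]]]]|[? [? [? [? [? [? [_ //]]]]]]]] :=
  reply_at (state_game (st_state n)) ei lt E.
by exists n, i.+1, s', i, p'; split.
Qed.

Lemma assertion_answered N m p A b c s :
  odd m -> asserts (st N) m p A -> is_attack p A s ->
  attack_plan b c p A = Some s ->
  (forall q B, s = Fm q B -> ready limit_asserts B) ->
  (exists q B, s = Fm q B /\ limit_attacks B) \/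
  (exists q C, [/\ is_defence p A s q C, limit_asserts C &
    forall D, A = Ex D -> exists x, C = inst D (Var x)]).
Proof.
move=> om asA at_ pl rd.
have [n0 rd0] : exists n0, forall q B, s = Fm q B -> ready (opponent_asserts (st n0)) B.
  case: s at_ pl rd => [q B|||| t|] at_ pl rd; try by exists 0.
  by have [n0 rd0] := ready_stage (rd q B erefl); exists n0 => _ _ [_ <-].
(* A common stage at which [A] has been asserted and the attack is affordable. *)
have ext := st_ext (leq_maxl N n0); have asA' := asserts_ext ext asA.
have [|n [i [ei lt E]]] := played (plan_attack asA' pl) erefl om (AnswerAttack asA' at_).
  move=> q B /rd0; apply: ready_mono => C; apply: opponent_asserts_ext.
  exact: st_ext (leq_maxr N n0).
have sS := st_state n; have gS := state_game sS.
have [[s' [p' [C [/= sC jr]]]]|[q [C [r [k [p' [A' [E' [sE kE] ja df]]]]]]]] := reply_at gS ei lt E.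
  by left; exists p', C; split=> //; exists n, i.+1, s', i, p'; split.
right; subst r k; exists q, C.
have [pE AE] : p' = p /\ A' = A.
  have [_ a1 _] := ja.
  apply: asserts_inj (asserts_ext (st_ext (leq_maxl n (maxn N n0))) a1) _.
  exact: asserts_ext (st_ext (leq_maxr _ _)) asA'.
subst p' A'; split=> //.
  by exists n, i.+1, q; split=> //; exists Def, (Some i).
move=> D AE; subst A; have sE := is_attackE at_; rewrite /= in sE; subst s.
have [t qt] : exists t, q = Matrix :: p /\ C = inst D t by inversion df; exists t.
case: qt => qE CE; subst q C.
have [_ /(_ t)] := state_named sS (n := i.+1) ei E'.
case; first by exists i, m, p, D.
move=> x [i' [k' [p' [D' [ja' [_ CE iE]]]]]]; subst i'.
by have [_ _ _ [DE]] := justified_attack_inj ja' ja; exists x; rewrite CE DE.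
Qed.

Notation model := (herbrand eps limit_asserts).
Notation env rho := (fun x : nat => decode (rho x)).

(** Were [B] true, its instance would be ready, P would have defended with it and O would have
    attacked it, which by the induction hypothesis makes [B] false. *)
Lemma option_refuted N m s k p A b c q B (rho : nat -> code) :
  (forall f, ffun f B -> exists i, eps i = Some f) ->
  (limit_attacks (fsubst (env rho) B) -> ~~ sat (I := model) rho B) ->
  odd m -> justified_attack (st N) m s k p A ->
  is_defence p A s q (fsubst (env rho) B) ->
  defence_plan b c p A s = Some (Fm q (fsubst (env rho) B)) ->
  ~~ sat (I := model) rho B.
Proof.
move=> ov IH om ja df pl; apply/negP => sB.
have := option_attacked om ja df pl (sat_ready ov sB).
by move/IH; rewrite sB.
Qed.

(** The truth lemma for a Hintikka set, proved for both sides at once because implication exchanges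
    them. The environment generalises the induction to instances. *)
Lemma limit_model A : (forall f, ffun f A -> exists i, eps i = Some f) ->
  forall rho : nat -> code,
  (limit_asserts (fsubst (env rho) A) -> sat (I := model) rho A) /\
  (limit_attacks (fsubst (env rho) A) -> ~~ sat (I := model) rho A).
Proof.
pose c0 : code := GenTree.Leaf 0.
elim: A => [r a|B IB C IC|B IB C IC|B IB C IC|B IB|B IB] ov rho.
- split; first by rewrite sat_atom // => ?; apply/asboolP.
  by move=> [N [m [s [k [p [_ [_ _ /is_attackE]]]]]]].
- have [|aB nB] := IB _ rho; first by move=> f ?; apply: ov; left.
  have [|aC nC] := IC _ rho; first by move=> f ?; apply: ov; right.
  split=> /=.
    move=> [N [m [p [om asA]]]]; apply/andP; split.
      have [] := assertion_answered om asA (AttAnd1 _ _ _) (b := true) (c := c0) erefl.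
      + by [].
      + by move=> [q [D []]].
      by move=> [q [D [df lD _]]]; apply: aB; inversion df; subst.
    have [] := assertion_answered om asA (AttAnd2 _ _ _) (b := false) (c := c0) erefl.
    + by [].
    + by move=> [q [D []]].
    by move=> [q [D [df lD _]]]; apply: aC; inversion df; subst.
  move=> [N [m [s [k [p [om ja]]]]]]; rewrite negb_and.
  have [_ _ /is_attackE sE] := ja; case: sE => sE; subst s.
    apply/orP; left; apply: (option_refuted (b := true) (c := c0) _ nB om ja (DefAnd1 _ _ _)) => //.
    by move=> f ?; apply: ov; left.
  apply/orP; right; apply: (option_refuted (b := true) (c := c0) _ nC om ja (DefAnd2 _ _ _)) => //.
  by move=> f ?; apply: ov; right.
- have ovB f : ffun f B -> exists i, eps i = Some f by move=> ?; apply: ov; left.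
  have ovC f : ffun f C -> exists i, eps i = Some f by move=> ?; apply: ov; right.
  have [aB nB] := IB ovB rho; have [aC nC] := IC ovC rho.
  split=> /=.
    move=> [N [m [p [om asA]]]].
    have [] := assertion_answered om asA (AttOr _ _ _) (b := true) (c := c0) erefl.
    + by [].
    + by move=> [q [D []]].
    move=> [q [D [df lD _]]]; inversion df; subst; apply/orP.
      by left; apply: aB.
    by right; apply: aC.
  move=> [N [m [s [k [p [om ja]]]]]]; rewrite negb_or.
  have [_ _ /is_attackE sE] := ja; subst s; apply/andP; split.
    exact: (option_refuted (b := true) (c := c0) ovB nB om ja (DefOr1 _ _ _)).
  exact: (option_refuted (b := false) (c := c0) ovC nC om ja (DefOr2 _ _ _)).
- have ovB f : ffun f B -> exists i, eps i = Some f by move=> ?; apply: ov; left.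
  have ovC f : ffun f C -> exists i, eps i = Some f by move=> ?; apply: ov; right.
  have [aB nB] := IB ovB rho; have [aC nC] := IC ovC rho.
  split=> /=.
    move=> [N [m [p [om asA]]]]; apply/implyP => sB.
    have [] := assertion_answered om asA (AttImp _ _ _) (b := true) (c := c0) erefl.
    (* A true antecedent is affordable, so P attacks with it. O cannot have attacked it in reply,
       being true, and so has defended with the consequent. *)
    + by move=> q D [_ <-]; apply: sat_ready.
    + by move=> [q [D [[_ <-] /nB]]]; rewrite sB.
    by move=> [q [D [df lD _]]]; inversion df; subst; apply: aC.
  move=> [N [m [s [k [p [om ja]]]]]]; rewrite negb_imply.
  have [E _ /is_attackE sE] := ja; subst s; apply/andP; split.
    by apply: aB; exists N, m, (Arg1 :: p); split=> //; exists Att, (Some k).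
  exact: (option_refuted (b := true) (c := c0) ovC nC om ja (DefImp _ _ _)).
- have ovB f : ffun f B -> exists i, eps i = Some f by apply: ov.
  have IB' c : (fun x => decode (scons c rho x)) = scons (decode c) (env rho).
    exact: scons_comp.
  split=> /=.
    move=> [N [m [p [om asA]]]]; apply/asboolP => c.
    have [aB _] := IB ovB (scons c rho).
    have [] := assertion_answered om asA (AttAll _ _ (decode c)) (b := true) (c := c) erefl.
    + by [].
    + by move=> [q [D []]].
    move=> [q [D [df lD _]]]; inversion df; subst; apply: aB.
    by rewrite IB' -inst_fsubst.
  move=> [N [m [s [k [p [om ja]]]]]].
  have [E _ /is_attackE [t sE]] := ja; subst s.
  have [/(_ t erefl)[x tx] _] := state_named (st_state N) om E; subst t.
  have [_ nB] := IB ovB (scons (GenTree.Leaf x : code) rho).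
  (* The variable of O's attack, seen as a leaf, is the counterexample. *)
  apply/asboolPn => /(_ (GenTree.Leaf x)); apply/negP.
  have iE : fsubst (env (scons (GenTree.Leaf x : code) rho)) B =
      inst (fsubst (up (env rho)) B) (Var x).
    by rewrite IB' inst_fsubst.
  apply: (option_refuted (b := true) (c := c0) ovB nB om ja (q := Matrix :: p)).
    by rewrite iE; constructor.
  by rewrite iE.
have ovB f : ffun f B -> exists i, eps i = Some f by apply: ov.
have IB' c : (fun x => decode (scons c rho x)) = scons (decode c) (env rho).
  exact: scons_comp.
split=> /=.
  move=> [N [m [p [om asA]]]]; apply/asboolP.
  have [] := assertion_answered om asA (AttEx _ _) (b := true) (c := c0) erefl.
  + by [].
  + by move=> [q [D []]].
  move=> [q [D [_ lD /(_ _ erefl)[x DE]]]]; exists (GenTree.Leaf x).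
  have [aB _] := IB ovB (scons (GenTree.Leaf x : code) rho); apply: aB.
  by rewrite IB' -inst_fsubst -DE.
move=> [N [m [s [k [p [om ja]]]]]].
have [_ _ /is_attackE sE] := ja; subst s.
apply/asboolPn => -[c]; apply/negP.
have [_ nB] := IB ovB (scons c rho).
have iE : fsubst (env (scons c rho)) B = inst (fsubst (up (env rho)) B) (decode c).
  by rewrite IB' inst_fsubst.
apply: (option_refuted (b := true) (c := c) ovB nB om ja (q := Matrix :: p)).
  by rewrite iE; constructor.
by rewrite iE.
Qed.

End Limit.

Hypothesis eps_ffun : forall f, ffun f F -> exists i, eps i = Some f.

Let start : entry L := ((Def, Fm [::] F), None).

(** The Herbrand interpretation without true atoms falsifies every atomic formula. *)
Lemma valid_not_atomic : classically_valid F -> ~ atomic F.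
Proof.
move=> vF [p [a FE]].
have := vF (herbrand eps (fun=> False)) (fun=> GenTree.Leaf 0).
by rewrite FE => /asboolP.
Qed.

Lemma valid_P_wins : classically_valid F -> P_wins [:: start].
Proof.
move=> vF; apply: contrapT => /not_P_wins[e [[le ce] lo]].
have g0 : game F [:: start] by apply: game_single; apply: valid_not_atomic.
have s1 : state [:: start; e].
  split=> //; apply: (@named_rcons [:: start] e) => //.
  by move=> [|n] d // _; rewrite onth_default.
have decE : (fun x => decode (GenTree.Leaf x : code)) = Var by [].
(* [F] holds even when no atom does, so P can afford it before O has asserted anything. *)
have rF : ready (fun=> False) F.
  have := sat_ready eps_ffun
    (vF (herbrand eps (fun=> False)) (fun x => (GenTree.Leaf x : code))).
  by rewrite decE fsubst_Var.
have [[s [p [B [[_ BE] ja]]]]|[? [? [? [? [? [? [_ //]]]]]]]] :=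
  reply_at (i := 0) (e := start) (state_game s1) isT isT erefl.
subst B; have [G0 [ext sG0 cG0]] := settle rF s1 (fun A => False_ind _) ja.
have [st [st0 sS sE sF]] := fair_stages sG0 cG0.
have [_ nF] := limit_model sS sE sF eps_ffun (fun x => (GenTree.Leaf x : code)).
suff lF : limit_attacks st (fsubst (fun x => decode (GenTree.Leaf x : code)) F).
  by have := nF lF; rewrite vF.
(* O's reply at index 1 attacks [F], asserted at index 0, and this attack survives in the limit. *)
rewrite decE fsubst_Var; exists 0, 1, s, 0, p; rewrite st0; split=> //.
exact: justified_attack_ext ja.
Qed.

End Completeness.

Theorem mainTheorem1 (L : language) (enum : nat -> nat)
    (enum_surj : forall x, exists n, enum n = x) (F : form L) :
  dialogically_valid enum F <-> classically_valid F.
Proof.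
split=> [[S [str win]] I rho|vF]; first exact: (winning_sat str win).
have [eps epsF] := ffun_enumerable F.
apply: P_wins_valid => //; first exact: (valid_not_atomic eps vF).
exact: (valid_P_wins enum epsF vF).
Qed.
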